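(* Fix $K\in L^2(0,2\pi)$. Then there exists $N=N(K)\in\mathbb{N}$ such that for every $n\in\mathbb{Z}$ with $|n|\geq N$ and $\langle\psi_n,K\rangle\neq0$, the function $$\Phi(\lambda)=1-e^{2\pi i\lambda}-\int_0^{2\pi}e^{i\lambda t}(-iK(t))\,dt$$ has exactly one simple root inside the disk with center point $n$ and radius $|\langle\psi_n,K\rangle|$. Moreover, for every $n\in\mathbb{Z}$ with $|n|\geq N$ and $\langle\psi_n,K\rangle=0$, the number $n$ is a simple zero of $\Phi$ and there are no other zeros of $\Phi$ in any disk with center point $n$ and radius less than $1/2$.
   Context: $\langle f,g\rangle=\int_0^{2\pi}\overline{f(t)}g(t)\,dt$ is the inner product of $L^2(0,2\pi)$ (complex-valued functions), and $\psi_n(x)=\frac{1}{\sqrt{2\pi}}e^{-inx}$ for $n\in\mathbb{Z}$. ''Exactly one simple root'' means that the number of roots counted with multiplicity is one. *)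

(* Defs.v *)
From HB Require Import structures.
From mathcomp Require Import all_boot all_order all_algebra.
From mathcomp Require Import complex.
From mathcomp Require Import all_classical all_reals all_analysis.

Set Implicit Arguments.
Unset Strict Implicit.
Unset Printing Implicit Defensive.

Import Order.TTheory GRing.Theory Num.Theory.
Import numFieldNormedType.Exports.

Local Open Scope classical_set_scope.
Local Open Scope ring_scope.
Local Open Scope complex_scope.

Section Complex.
Context {R : realType}.

Notation mu := (@lebesgue_measure R).

Definition cexp (z : R[i]) : R[i] :=
  (expR (complex.Re z) * cos (complex.Im z)) +i* (expR (complex.Re z) * sin (complex.Im z)).

Definition cintegral (D : set R) (f : R -> R[i]) : R[i] :=
  (\int[mu]_(t in D) complex.Re (f t)) +i* (\int[mu]_(t in D) complex.Im (f t)).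

(* Functions rather than classes modulo almost everywhere equality;
   [normc] is the modulus as a real number. *)
Definition squareIntegrable (D : set R) (f : R -> R[i]) : Prop :=
  [/\ measurable_fun D (fun t => complex.Re (f t)),
      measurable_fun D (fun t => complex.Im (f t)) &
      (\int[mu]_(t in D) (ComplexField.Normc.normc (f t) ^+ 2)%:E < +oo)%E].

Definition I02pi : set R := `]0, 2 * pi[.

Definition inner (f g : R -> R[i]) : R[i] :=
  cintegral I02pi (fun t => (f t)^* * g t).

Definition psi (n : int) (x : R) : R[i] :=
  (Num.sqrt (2 * pi))^-1%:C * cexp (- ('i * n%:~R * x%:C)).

Definition Phi (K : R -> R[i]) (z : R[i]) : R[i] :=
  1 - cexp (2 * pi%:C * 'i * z)
    - cintegral I02pi (fun t => cexp ('i * z * t%:C) * (- ('i * K t))).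

(* [R[i]^o] carries the topology of [R[i]] and its structure of normed space
   over itself, so that derivability and [derive1n] are in the complex sense. *)
Definition zero_of_order (f : R[i]^o -> R[i]^o) (z : R[i]^o) (m : nat) : Prop :=
  [/\ \forall w \near z, derivable f w 1,
      forall k, (k < m)%N -> derive1n k f z = 0 &
      derive1n m f z != 0].

Definition simple_zero (f : R[i]^o -> R[i]^o) (z : R[i]^o) : Prop :=
  zero_of_order f z 1.

(* [s] lists the distinct zeros of [f] in [D], [m] gives their orders. *)
Definition number_of_zeros (f : R[i]^o -> R[i]^o) (D : set R[i]^o) (n : nat)
    : Prop :=
  exists (s : seq R[i]^o) (m : R[i]^o -> nat),
    [/\ uniq s,
        forall z, z \in s <-> D z /\ f z = 0,
        forall z, z \in s -> zero_of_order f z (m z) &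
        (\sum_(z <- s) m z)%N = n].

Definition disk (c r : R[i]) : set R[i]^o := ball (c : R[i]^o) r.

End Complex.

(* Main.v *)
(* Near [n], writing [z = n + w], periodicity gives
   [Phi z = 1 - e^(2 pi i w) + i F(n + w)] with
   [F(z) = \int e^(i z t) K(t) dt] and [F(n) = sqrt (2 pi) <psi_n, K>].
   A Riemann-Lebesgue argument that is uniform in [w] shows that
   [w |-> F(n + w)] has an arbitrarily small Lipschitz constant on
   [|w| <= 1/2] once [|n|] is large.  Since [|e^z - 1| >= c |z|] for
   [|z| <= pi], [Phi] is then expanding near [n]: its zeros there are unique
   and simple.  Existence, with a zero close to [n + <psi_n, K> / sqrt (2 pi)],
   comes from the contraction [w |-> w + Phi (n + w) / (2 pi i)] of the disk of
   radius [|<psi_n, K>|]. *)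
Require Import Defs.
From mathcomp Require Import all_boot all_order all_algebra.
From mathcomp Require Import complex.
From mathcomp Require Import all_classical all_reals all_analysis.
From mathcomp Require Import measurable_realfun.
From mathcomp Require Import ring lra.

Set Implicit Arguments.
Unset Strict Implicit.
Unset Printing Implicit Defensive.

Import Order.TTheory GRing.Theory Num.Theory.
Import numFieldNormedType.Exports.
Import HBSimple.

Local Open Scope classical_set_scope.
Local Open Scope ring_scope.
Local Open Scope complex_scope.

(** * Riemann-Lebesgue lemma for bounded kernels *)

(** The disk of radius [|<psi_n, K>|] shrinks to its centre as [|n|] grows, so a perturbation that
    is merely small would not do: it has to be small relative to the displacement. This is why the
    Riemann-Lebesgue argument is run on the difference quotients [(e^(i (n + w1) t) - e^(i (n + w2)
    t)) / |w1 - w2|] and not only on [e^(i n t)]. These kernels are bounded, and their integrals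
    over each interval []0, b[] are O(1 / |n|), uniformly in [w1] and [w2]. A bounded sequence of
    kernels whose integrals over all []0, b[] tend to 0 is null against every integrable function;
    uniformity in the index then follows by contradiction, from a sequence of bad indices. With
    Lipschitz estimates in hand, no contour integral or argument principle is needed to count zeros.
    The radius leaves room for the fixed point because the approximate zero lies at distance
    [|<psi_n, K>| / sqrt (2 pi)] from [n], at most half the radius since [pi >= 2]. *)

Lemma integrable_bounded_mul d (T : measurableType d) (R : realType)
    (mu : {measure set T -> \bar R}) (D : set T) (h f : T -> R) (C : R) :
  measurable D -> measurable_fun D h -> (forall x, D x -> `|h x| <= C) ->
  mu.-integrable D (EFin \o f) ->
  mu.-integrable D (EFin \o (fun x => h x * f x)).
Proof.
move=> mD mh hC fi.
have : mu.-integrable D ((EFin \o h) \* (EFin \o f))%E.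
  apply: integrableMr => //.
  exists C; split; first by rewrite num_real.
  by move=> M CM x Dx; rewrite /= (le_trans (hC _ Dx))//; exact: ltW.
by apply: eq_integrable => // x _ /=; rewrite EFinM.
Qed.

Section RiemannLebesgue.
Context d (T : measurableType d) (R : realType) (mu : {measure set T -> \bar R}).
Variables (D : set T) (k : nat -> T -> R) (C : R).
Hypotheses (mD : measurable D) (Doo : (mu D < +oo)%E).
Hypotheses (mk : forall n, measurable_fun D (k n)).
Hypothesis kC : forall n x, D x -> `|k n x| <= C.

Definition kernel_null (f : T -> R) :=
  \int[mu]_(x in D) (k n x * f x) @[n --> \oo] --> (0 : R).

Lemma integrable_kernelM (f : T -> R) n :
  mu.-integrable D (EFin \o f) ->
  mu.-integrable D (EFin \o (fun x => k n x * f x)).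
Proof.
by apply: integrable_bounded_mul => // x; exact: kC.
Qed.

Lemma kernel_nullD (f g : T -> R) :
  mu.-integrable D (EFin \o f) -> mu.-integrable D (EFin \o g) ->
  kernel_null f -> kernel_null g -> kernel_null (fun x => f x + g x).
Proof.
move=> fi gi hf hg; rewrite /kernel_null -[0](addr0 0).
under eq_cvg => n.
  rewrite (@eq_Rintegral _ _ _ _ _ (fun x => k n x * f x + k n x * g x)).
    rewrite RintegralD //; last 2 first.
    exact: integrable_kernelM.
    exact: integrable_kernelM.
  over.
  by move=> x _; rewrite mulrDr.
exact: cvgD.
Qed.

Lemma kernel_nullZ (f : T -> R) c :
  mu.-integrable D (EFin \o f) ->
  kernel_null f -> kernel_null (fun x => c * f x).
Proof.
move=> fi hf; rewrite /kernel_null -(mulr0 c).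
under eq_cvg => n.
  rewrite (@eq_Rintegral _ _ _ _ _ (fun x => c * (k n x * f x))).
    rewrite RintegralZl //; last exact: integrable_kernelM.
  over.
  by move=> x _; rewrite mulrCA.
exact: cvgMr.
Qed.

(** The uniform bound on the kernels makes the integrals against [f] and against [g m] differ by at
    most a constant times the L^1 distance, uniformly in [n]; fix one good [m], then let [n]
    grow. *)
Lemma kernel_null_lim (f : T -> R) (g : nat -> T -> R) :
  mu.-integrable D (EFin \o f) -> (forall m, mu.-integrable D (EFin \o g m)) ->
  (\int[mu]_(x in D) `|(g m x)%:E - (f x)%:E|)%E @[m --> \oo] --> 0%E ->
  (forall m, kernel_null (g m)) -> kernel_null f.
Proof.
move=> fi gi gf hg; apply/cvgrPdist_lt => e e0.
(* [C] may be 0, or even negative when [D] is empty; [|C| + 1] is a positive bound in every case. *)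
have Cp : 0 < `|C| + 1 by rewrite ltr_wpDl.
have e1 : 0 < e / 2 / (`|C| + 1) by rewrite !divr_gt0.
have /fine_cvgP[fn gf0] := gf.
move/cvgrPdist_lt : gf0 => /(_ _ e1) gf0.
have [m [finm hm]] : exists m,
    (\int[mu]_(x in D) `|(g m x)%:E - (f x)%:E|)%E \is a fin_num /\
   `|0 - fine (\int[mu]_(x in D) `|(g m x)%:E - (f x)%:E|)%E| < e / 2 / (`|C| + 1).
  have [m _ H] := filterI fn gf0.
  by exists m; apply: (H m) => /=.
have e2 : 0 < e / 2 by rewrite divr_gt0.
move/cvgrPdist_lt : (hg m) => /(_ _ e2); apply: filterS => n.
rewrite !sub0r !normrN => Hn.
have dfi : mu.-integrable D (EFin \o (fun x => g m x - f x)).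
  by have := integrableB mD (gi m) fi; apply: eq_integrable => // x _ /=; rewrite EFinB.
have -> : \int[mu]_(x in D) (k n x * f x) = \int[mu]_(x in D) (k n x * g m x)
    - \int[mu]_(x in D) (k n x * (g m x - f x)).
  rewrite -RintegralB //; [|exact: integrable_kernelM..].
  by apply: eq_Rintegral => x _; rewrite -mulrBr opprB addrC subrK.
rewrite (le_lt_trans (ler_normB _ _))// (splitr e) ltr_leD //.
rewrite (le_trans (le_normr_Rintegral mD (integrable_kernelM _ dfi)))//.
move: hm; rewrite sub0r normrN ger0_norm; last first.
  by apply: fine_ge0; apply: integral_ge0 => x _; exact: abse_ge0.
rewrite ltr_pdivlMr // => /ltW hm; apply: le_trans hm.
have ai : mu.-integrable D (EFin \o (fun x => `|g m x - f x|)).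
  by have := integrable_abse dfi; apply: eq_integrable => // x _ /=.
have -> : (\int[mu]_(x in D) `|(g m x)%:E - (f x)%:E|)%E =
   (\int[mu]_(x in D) (`|g m x - f x|)%:E)%E by [].
rewrite -RintegralZr //; apply: le_Rintegral => //.
- have := integrable_abse (integrable_kernelM n dfi).
  by apply: eq_integrable => // x _ /=.
- have := integrableZr mD (`|C| + 1) ai.
  by apply: eq_integrable => // x _ /=; rewrite EFinM.
- move=> x Dx; rewrite normrM mulrC ler_wpM2l//.
  by rewrite (le_trans (kC _ Dx))// (le_trans (ler_norm _))// lerDl.
Qed.

Lemma integrable_indic_fin (A : set T) : measurable A ->
  mu.-integrable D (EFin \o (\1_A : T -> R)).
Proof.
move=> mA; apply: measurable_bounded_integrable => //.
exists 1; split; first by rewrite num_real.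
by move=> M M1 x _; rewrite /= ger0_norm // indicE (le_trans _ (ltW M1)) // lern1 leq_b1.
Qed.

Variable G : set (set T).
Hypothesis measE : @measurable d T = <<s G >>.
Hypothesis GI : setI_closed G.
Hypothesis kT : \int[mu]_(x in D) (k n x) @[n --> \oo] --> (0 : R).
Hypothesis kG : forall A, G A ->
  \int[mu]_(x in D `&` A) (k n x) @[n --> \oo] --> (0 : R).

(* Sets whose indicator is [kernel_null] form a Dynkin system. *)
Lemma kernel_null_indic (A : set T) : measurable A -> kernel_null \1_A.
Proof.
have hT : kernel_null \1_[set: T].
  apply: cvg_trans kT; apply: near_eq_cvg; apply: nearW => n.
  by apply: eq_Rintegral => x _; rewrite indicT mulr1.
rewrite measE; move: A; apply: dynkin_induction => //.
- move=> A GA; apply: cvg_trans (kG GA); apply: near_eq_cvg; apply: nearW => n.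
  rewrite Rintegral_mkcondr; apply: eq_Rintegral => x _.
  by rewrite patchE indicE; case: (x \in A); rewrite ?mulr1 ?mulr0.
- move=> A mA hA.
  have -> : \1_(~` A) = (fun x => \1_[set: T] x + (-1) * \1_A x) :> (T -> R).
    apply/funext => x; rewrite !indicE in_setT in_setC.
    by case: (x \in A); rewrite ?mulN1r ?subrr ?subr0 //= mulr0 addr0.
  apply: kernel_nullD => //; first exact: integrable_indic_fin.
    have := integrableZl mD (-1) (integrable_indic_fin mA).
    by apply: eq_integrable => // x _ /=.
  by apply: kernel_nullZ => //; exact: integrable_indic_fin.
- move=> F mF tF hF.
  (* The partial unions converge to the union in L^1, dominated by 1 on a set of finite measure.
     Disjointness makes the indicators of the partial unions finite sums. *)
  pose B m := \big[setU/set0]_(i < m) F i.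
  have mB m : measurable (B m) by apply: bigsetU_measurable.
  have mU : measurable (\bigcup_k F k) by apply: bigcupT_measurable.
  apply: (@kernel_null_lim _ (fun m => \1_(B m))).
  + exact: integrable_indic_fin.
  + by move=> m; exact: integrable_indic_fin.
  + have [|||||_ H _] := @dominated_convergence _ _ _ mu D mD
      (fun m x => (\1_(B m) x)%:E) (fun x => (\1_(\bigcup_k F k) x)%:E)
      (fun x => (\1_[set: T] x)%:E).
    * by move=> m; apply/measurable_EFinP; exact: measurable_funTS.
    * by apply/measurable_EFinP; exact: measurable_indic.
    * apply: aeW => x Dx; apply/fine_cvgP; split; first by apply: nearW => n.
      apply: cvg_near_cst; case: (pselect ((\bigcup_k F k) x)) => [[i _ Fix]|nF].
        exists i.+1 => //= m /= im; rewrite !indicE /= !mem_set //.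
          by exists i.
        by rewrite /B -bigcup_mkord; exists i.
      apply: nearW => m; rewrite /= !indicE !memNset //.
      by rewrite /B -bigcup_mkord => -[i _ Fi]; apply: nF; exists i.
    * exact: integrable_indic_fin.
    * by apply: aeW => x m Dx; rewrite /= lee_fin indicT ger0_norm // indicE lern1 leq_b1.
    by [].
  + elim=> [|m IH].
      rewrite /B big_ord0 indic0; apply: cvg_near_cst; apply: nearW => n.
      by rewrite (@eq_Rintegral _ _ _ _ _ (cst 0)) ?Rintegral_cst ?mul0r // => x _; rewrite mulr0.
    have -> : \1_(B m.+1) = (fun x => \1_(B m) x + \1_(F m) x) :> (T -> R).
      rewrite /B big_ord_recr /=; rewrite -/(B m); apply/funext => x.
      rewrite !indicE in_setU.
      case: (boolP (x \in B m)); case: (boolP (x \in F m)); rewrite ?addr0 ?add0r //=.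
      rewrite !inE /B -bigcup_mkord => Fm [i /= im Fi].
      have := tF i m I I; rewrite /= => H.
      by move: im; rewrite H ?ltnn //; exists x.
    by apply: kernel_nullD; [exact: integrable_indic_fin..|exact: IH|exact: hF].
Qed.

(** Simple functions are L^1-dense and are finite combinations of indicators. *)
Lemma kernel_null_integrable (f : T -> R) :
  mu.-integrable D (EFin \o f) -> kernel_null f.
Proof.
move=> fi; have [g [gi _ gf]] := approximation_sfun_integrable mD fi.
refine (@kernel_null_lim f (fun m => (g m : T -> R)) fi gi _ _).
  apply: cvg_trans gf; apply: near_eq_cvg; apply: nearW => n.
  by apply: eq_integral => x _ /=; rewrite distrC.
move=> m; set h := g m; pose hf := (h : T -> R).
pose s := finmap.enum_fset (fset_set (range hf)).
rewrite (_ : (h : T -> R) =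
    (fun x => \sum_(i < size s) s`_i * \1_(hf @^-1` [set s`_i]) x)); last first.
  by apply/funext => x; exact: (fimfunEord (h : {fimfun T >-> R}) x).
(* The induction runs over all [N], including those past the size of [s], where [nth] returns the
   default 0. *)
suff H : forall N, mu.-integrable D (EFin \o (fun x =>
     \sum_(i < N) s`_i * \1_(hf @^-1` [set s`_i]) x)) /\
     kernel_null (fun x => \sum_(i < N) s`_i * \1_(hf @^-1` [set s`_i]) x).
  by case: (H (size s)).
elim=> [|N [IH1 IH2]].
  split.
    have := integrable_indic_fin measurable0; apply: eq_integrable => // x _ /=.
    by rewrite big_ord0 indic0.
  apply: cvg_near_cst; apply: nearW => n.
  rewrite (@eq_Rintegral _ _ _ _ _ (cst 0)) ?Rintegral_cst ?mul0r // => x _.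
  by rewrite big_ord0 mulr0.
have mh y : measurable (hf @^-1` [set y]).
  by rewrite -[X in measurable X]setTI; exact: measurable_funP.
have i1 : mu.-integrable D (EFin \o (fun x => s`_N * \1_(hf @^-1` [set s`_N]) x)).
  have := integrableZl mD s`_N (integrable_indic_fin (mh s`_N)).
  by apply: eq_integrable => // x _ /=; rewrite EFinM.
under eq_fun do rewrite big_ord_recr /=.
split.
  have := integrableD mD IH1 i1; exact: eq_integrable.
apply: kernel_nullD => //; apply: kernel_nullZ; first exact: integrable_indic_fin.
exact: kernel_null_indic.
Qed.

End RiemannLebesgue.

(** * The complex exponential *)

Section ComplexExponential.
Context {R : realType}.
Implicit Types (z w a b : R[i]) (x y u : R).

Notation normc := ComplexField.Normc.normc.
Notation Re := complex.Re.
Notation Im := complex.Im.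

Lemma normc_ge0 z : 0 <= normc z.
Proof. by case: z => x y; exact: sqrtr_ge0. Qed.

Lemma normc_sqr z : normc z ^+ 2 = Re z ^+ 2 + Im z ^+ 2.
Proof. by case: z => x y; rewrite sqr_sqrtr // addr_ge0 ?sqr_ge0. Qed.

Lemma le_normc x z : 0 <= x -> (x <= normc z) = (x ^+ 2 <= Re z ^+ 2 + Im z ^+ 2).
Proof. by move=> x0; rewrite -normc_sqr ler_pXn2r // nnegrE normc_ge0. Qed.

Lemma normr_Re_le z : `|Re z| <= normc z.
Proof. by rewrite le_normc // real_normK ?num_real // lerDl sqr_ge0. Qed.

Lemma normr_Im_le z : `|Im z| <= normc z.
Proof. by rewrite le_normc // real_normK ?num_real // lerDr sqr_ge0. Qed.

Lemma normc_le z : normc z <= `|Re z| + `|Im z|.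
Proof.
rewrite -[leRHS]ger0_norm ?addr_ge0 // -sqrtr_sqr.
case: z => x y; rewrite /= ler_wsqrtr // sqrrD !real_normK ?num_real //.
by rewrite lerD2r lerDl mulrn_wge0 // mulr_ge0.
Qed.

Lemma normc_real x : normc x%:C = `|x|.
Proof. by rewrite /= expr0n /= addr0 sqrtr_sqr. Qed.

Lemma normc_i : normc ('i : R[i]) = 1.
Proof. by rewrite /= expr0n /= add0r expr1n sqrtr1. Qed.

Lemma normcB z w : normc (z - w) <= normc z + normc w.
Proof. by rewrite -(normcN w) le_normcD. Qed.

Lemma cexp0 : cexp 0 = 1 :> R[i].
Proof. by rewrite /cexp /= expR0 cos0 sin0 mulr1 mulr0. Qed.

Lemma cexpD z w : cexp (z + w) = cexp z * cexp w.
Proof.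
case: z w => [x y] [u v]; apply/eqP; rewrite eq_complex /= expRD cosD sinD.
by apply/andP; split; apply/eqP; ring.
Qed.

Lemma normc_cexp z : normc (cexp z) = expR (Re z).
Proof.
case: z => x y; rewrite /cexp /= !exprMn -mulrDr cos2Dsin2 mulr1 sqrtr_sqr.
by rewrite ger0_norm // expR_ge0.
Qed.

(** The mean value theorem based at 0 for either sign of [x], the form in which the bounds on sine
    and cosine below use it. *)
Lemma is_derive_mean (f df : R -> R) x (hf : forall t : R, is_derive t 1 f (df t)) :
  exists2 t, `|t| <= `|x| & f x - f 0 = df t * x.
Proof.
have cf (a b : R) : {within `[a, b], continuous f}.
  apply: derivable_within_continuous => t _.
  by have [] := hf t.
have [x0|x0] := leP 0 x.
  have [t + ->] := MVT_segment x0 (fun t _ => hf t) (cf _ _).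
  rewrite in_itv /= subr0 => /andP[t0 tx]; exists t => //.
  by rewrite !ger0_norm.
have [t + h] := MVT_segment (ltW x0) (fun t _ => hf t) (cf _ _).
rewrite in_itv /= => /andP[xt t0]; exists t; last first.
  by rewrite -opprB h sub0r mulrN opprK.
by rewrite !ler0_norm // ?lerN2 // ltW.
Qed.

Lemma normr_sin_le x : `|sin x| <= `|x|.
Proof.
have [t _] := is_derive_mean x (@is_derive_sin R).
rewrite sin0 subr0 => ->; rewrite normrM -[leRHS]mul1r ler_wpM2r //.
exact: cos_max.
Qed.

Lemma normr_cosB1_le x : `|cos x - 1| <= `|x|.
Proof.
have [t _] := is_derive_mean x (@is_derive_cos R).
rewrite cos0 => ->; rewrite normrM -[leRHS]mul1r ler_wpM2r //.
by rewrite normrN; exact: sin_max.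
Qed.

Lemma normr_cosB1_le2 x : `|cos x - 1| <= `|x| ^+ 2.
Proof.
have [t tx] := is_derive_mean x (@is_derive_cos R).
rewrite cos0 => ->; rewrite normrM expr2 ler_wpM2r //.
by rewrite normrN (le_trans (normr_sin_le _)).
Qed.

Lemma normr_sinB_le2 x : `|sin x - x| <= `|x| ^+ 2.
Proof.
have [t tx] := is_derive_mean x (@is_derive_sin R).
rewrite sin0 subr0 => ->; rewrite -{2}(mul1r x) -mulrBl normrM expr2 ler_wpM2r //.
exact: le_trans (normr_cosB1_le _) tx.
Qed.

(** Multiply [1 - x <= expR (- x)] by [expR x]. *)
Lemma expRB1_le x : expR x - 1 <= x * expR x.
Proof.
have := expR_ge1Dx (- x); have := expR_gt0 x.
have : expR x * expR (- x) = 1 by rewrite -expRD subrr expR0.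
nra.
Qed.

Lemma normr_expRB1_le x : `|expR x - 1| <= `|x| * expR `|x|.
Proof.
have h1 := expRB1_le x; have h2 := expR_ge1Dx x.
have [x0|x0] := leP 0 x.
  by rewrite (ger0_norm x0) ger0_norm; lra.
have e1 := expR_ge1Dx (- x).
rewrite (ltr0_norm x0) ler0_norm; last by rewrite subr_le0 expR_le1 ltW.
nra.
Qed.

(** By [expRB1_le], [expR x - 1 - x] lies between 0 and [x * (expR x - 1)]. *)
Lemma normr_expRB1D_le x : `|expR x - 1 - x| <= `|x| ^+ 2 * expR `|x|.
Proof.
have h1 := expRB1_le x; have h2 := expR_ge1Dx x.
rewrite ger0_norm; last by lra.
rewrite expr2 -mulrA; apply: le_trans (ler_wpM2l (normr_ge0 x) (normr_expRB1_le x)).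
by rewrite -normrM; apply: le_trans (ler_norm _); lra.
Qed.

Lemma expR_Re_le z : expR (Re z) <= expR (normc z).
Proof. by rewrite ler_expR (le_trans (ler_norm _)) // normr_Re_le. Qed.


(** The factor 3 counts the real pieces into which the real and imaginary parts split, each at most
    [expR (normc z) * normc z]. *)
Lemma normc_cexpB1_le z : normc (cexp z - 1) <= 3 * expR (normc z) * normc z.
Proof.
set M := normc z; set E := expR M.
have ReM : `|Re z| <= M := normr_Re_le z.
have ImM : `|Im z| <= M := normr_Im_le z.
have eE : `|expR (Re z)| <= E by rewrite ger0_norm ?expR_ge0 // expR_Re_le.
have h1 : `|expR (Re z) * (cos (Im z) - 1)| <= E * M.
  by rewrite normrM ler_pM // (le_trans (normr_cosB1_le _)).
have h2 : `|expR (Re z) - 1| <= M * E.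
  by rewrite (le_trans (normr_expRB1_le _)) // ler_pM ?expR_ge0 // ler_expR.
have h3 : `|expR (Re z) * sin (Im z)| <= E * M.
  by rewrite normrM ler_pM // (le_trans (normr_sin_le _)).
have -> : cexp z - 1 = (expR (Re z) * (cos (Im z) - 1) + (expR (Re z) - 1))
    +i* (expR (Re z) * sin (Im z)).
  by apply/eqP; rewrite eq_complex /=; apply/andP; split; apply/eqP; ring.
rewrite (le_trans (normc_le _)) //=.
have := ler_normD (expR (Re z) * (cos (Im z) - 1)) (expR (Re z) - 1).
nra.
Qed.

Lemma normc_cexpB1D_le z :
  normc (cexp z - 1 - z) <= 4 * expR (normc z) * normc z ^+ 2.
Proof.
set M := normc z; set E := expR M.
have M0 : 0 <= M := normc_ge0 z.
have ReM : `|Re z| <= M := normr_Re_le z.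
have ImM : `|Im z| <= M := normr_Im_le z.
have eE : `|expR (Re z)| <= E by rewrite ger0_norm ?expR_ge0 // expR_Re_le.
have M2 x : `|x| <= M -> `|x| ^+ 2 <= M ^+ 2.
  by move=> xM; rewrite ler_pXn2r // nnegrE.
have h1 : `|expR (Re z) * (cos (Im z) - 1)| <= E * M ^+ 2.
  by rewrite normrM ler_pM // (le_trans (normr_cosB1_le2 _)) // M2.
have h2 : `|expR (Re z) - 1 - Re z| <= M ^+ 2 * E.
  rewrite (le_trans (normr_expRB1D_le _)) // ler_pM ?expR_ge0 ?exprn_ge0 //.
    exact: M2.
  by rewrite ler_expR.
have h3 : `|expR (Re z) * (sin (Im z) - Im z)| <= E * M ^+ 2.
  by rewrite normrM ler_pM // (le_trans (normr_sinB_le2 _)) // M2.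
have h4 : `|(expR (Re z) - 1) * Im z| <= E * M ^+ 2.
  rewrite normrM expr2 mulrA (mulrC E) ler_pM //.
  by rewrite (le_trans (normr_expRB1_le _)) // ler_pM ?expR_ge0 // ler_expR.
(* Four pieces, each of second order in [normc z], whence the factor 4. *)
have -> : cexp z - 1 - z =
    (expR (Re z) * (cos (Im z) - 1) + (expR (Re z) - 1 - Re z))
    +i* (expR (Re z) * (sin (Im z) - Im z) + (expR (Re z) - 1) * Im z).
  case: z @M @E M0 ReM ImM eE M2 h1 h2 h3 h4 => x y * /=.
  by apply/eqP; rewrite eq_complex /=; apply/andP; split; apply/eqP; ring.
rewrite (le_trans (normc_le _)) //=.
have := ler_normD (expR (Re z) * (cos (Im z) - 1)) (expR (Re z) - 1 - Re z).
have := ler_normD (expR (Re z) * (sin (Im z) - Im z)) ((expR (Re z) - 1) * Im z).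
nra.
Qed.

(** With [v = u / 2], [sin u = 2 sin v cos v] and [sin v = v cos t] for some [|t| <= v]. Since
    [v <= pi / 4], the double-angle formula bounds both squared cosines below by 1/2, so
    [2 v cos t cos v >= v]. *)
Lemma sin_ge_half u : 0 <= u <= pi / 2 -> u / 2 <= sin u.
Proof.
move=> /andP[u0 upi]; pose v := u / 2.
have cos2 t : `|t| <= v -> 0 <= cos t /\ 1 / 2 <= cos t ^+ 2.
  rewrite ler_norml => /andP[t1 t2].
  have p0 := pi_ge0 R.
  have : 0 <= cos (t *+ 2).
    apply: cos_ge0_pihalf; rewrite -[t *+ 2]mulr_natl.
    by apply/andP; split; rewrite /v in t1 t2; lra.
  rewrite cos_mulr2n => h; split; last by lra.
  by apply: cos_ge0_pihalf; apply/andP; split; rewrite /v in t1 t2; lra.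
have v0 : 0 <= v by rewrite divr_ge0.
have [t tv] := is_derive_mean v (@is_derive_sin R).
rewrite sin0 subr0 => sv.
have [c0 c2] : 0 <= cos v /\ 1 / 2 <= cos v ^+ 2 by apply: cos2; rewrite ger0_norm.
have [d0 d2] : 0 <= cos t /\ 1 / 2 <= cos t ^+ 2.
  by apply: cos2; rewrite (le_trans tv) // ger0_norm.
have -> : sin u = sin (v *+ 2) by congr sin; rewrite -mulr_natl /v; lra.
rewrite sin_mulr2n sv -/v.
have cd0 : 0 <= cos t * cos v by rewrite mulr_ge0.
have cd2 : (1 / 2) * (1 / 2) <= (cos t * cos v) ^+ 2 by rewrite exprMn ler_pM //; lra.
have cd : 1 / 2 <= cos t * cos v by nra.
rewrite -[leRHS]mulr_natl; nra.
Qed.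

(** For [z = x + i y], [|e^z - 1|^2 = (e^x - 1)^2 + 4 e^x sin^2 (y / 2)], which separates the two
    coordinates. The bound [|y| <= pi] keeps [y / 2] where [|sin (y / 2)| >= |y| / 4], away from the
    other zeros of [e^z - 1]. *)
Lemma normc_cexpB1_ge z : normc z <= pi ->
  expR (- pi) / 2 * normc z <= normc (cexp z - 1).
Proof.
move=> zpi; have p0 := pi_ge0 R.
have := le_trans (normr_Re_le z) zpi; have := le_trans (normr_Im_le z) zpi.
set x := Re z; set y := Im z => ypi xpi.
have hx : `|x| * expR (- pi) <= `|expR x - 1|.
  have h0 := expR_gt0 (- pi : R).
  have e1 : expR (- pi : R) <= 1 by rewrite expR_le1 oppr_le0.
  have h1 := expRB1_le x; have h2 := expR_ge1Dx x.
  have [x0|x0] := leP 0 x.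
    rewrite (ger0_norm x0) ger0_norm; last by lra.
    nra.
  rewrite (ltr0_norm x0) ler0_norm; last by rewrite subr_le0 expR_le1 ltW.
  have : expR (- pi) <= expR x.
    by rewrite ler_expR; move: xpi; rewrite ler_norml => /andP[].
  nra.
have hy : `|y| / 4 <= `|sin (y / 2)|.
  have [y0|y0] := leP 0 y.
    rewrite (ger0_norm y0) in ypi *.
    rewrite (le_trans _ (ler_norm _)) //.
    rewrite (le_trans _ (@sin_ge_half (y / 2) _)) //; first by lra.
    by apply/andP; split; lra.
  rewrite (ltr0_norm y0) in ypi *.
  rewrite -normrN -sinN (le_trans _ (ler_norm _)) //.
  rewrite (le_trans _ (@sin_ge_half (- (y / 2)) _)) //; first by lra.
  by apply/andP; split; lra.
have cy : cos y = 1 - 2 * sin (y / 2) ^+ 2.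
  have -> : cos y = cos ((y / 2) *+ 2) by congr cos; rewrite -mulr_natl; lra.
  by rewrite cos_mulr2n cos2sin2 -mulr_natl; ring.
rewrite le_normc; last by rewrite mulr_ge0 ?normc_ge0 // divr_ge0 ?expR_ge0.
have -> : Re (cexp z - 1) = expR x * cos y - 1 by [].
have -> : Im (cexp z - 1) = expR x * sin y by rewrite /= subr0.
have -> : (expR x * cos y - 1) ^+ 2 + (expR x * sin y) ^+ 2 =
   (expR x - 1) ^+ 2 + 4 * expR x * sin (y / 2) ^+ 2.
  have := cos2Dsin2 y; rewrite !exprMn cy => h.
  have -> : sin y ^+ 2 = 1 - (1 - 2 * sin (y / 2) ^+ 2) ^+ 2 by lra.
  by ring.
rewrite exprMn normc_sqr -/x -/y.
have q1 : (`|x| * expR (- pi)) ^+ 2 <= (expR x - 1) ^+ 2.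
  by rewrite -[leRHS]real_normK ?num_real // ler_pXn2r // nnegrE mulr_ge0 ?expR_ge0.
have q2 : (`|y| / 4) ^+ 2 <= sin (y / 2) ^+ 2.
  by rewrite -[leRHS]real_normK ?num_real // ler_pXn2r // nnegrE divr_ge0.
rewrite exprMn real_normK ?num_real // in q1.
rewrite exprMn real_normK ?num_real // in q2.
have e1 : expR (- pi) <= expR x.
  by rewrite ler_expR; move: xpi; rewrite ler_norml => /andP[].
have e2 : expR (- pi) ^+ 2 <= expR (- pi : R).
  by rewrite expr2 ler_piMl ?expR_ge0 // expR_le1 oppr_le0.
have := expR_gt0 (- pi : R); have := sqr_ge0 x; have := sqr_ge0 y.
(* The goal is now polynomial: [q1] controls the part [p^2 X / 4], and
   [4 e s >= p Y / 4 >= p^2 Y / 4] since [p <= 1]. *)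
move: (expR (- pi)) (expR x) (sin (y / 2) ^+ 2) (x ^+ 2) (y ^+ 2) q1 q2 e1 e2.
move=> p e s X Y; move=> q1 q2 e1 e2 Y0 X0 p0'.
have : p * (Y / 16) <= e * s by rewrite ler_pM //; lra.
have : p ^+ 2 * Y <= p * Y by rewrite ler_wpM2r.
have : 0 <= p ^+ 2 * X by rewrite mulr_ge0 ?sqr_ge0.
lra.
Qed.

End ComplexExponential.

(** * Complex-valued integrals *)

Section ComplexIntegral.
Context {R : realType}.
Notation mu := (@lebesgue_measure R).
Notation normc := ComplexField.Normc.normc.
Notation Re := complex.Re.
Notation Im := complex.Im.
Implicit Types (D : set (measurableTypeR R)) (f g k K : R -> R[i]) (z w : R[i]).

Definition complex_measurable (D : set (measurableTypeR R)) f :=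
  measurable_fun D (fun t => Re (f t)) /\ measurable_fun D (fun t => Im (f t)).

Definition complex_integrable D f :=
  mu.-integrable D (EFin \o (fun t => Re (f t))) /\
  mu.-integrable D (EFin \o (fun t => Im (f t))).

Lemma Re_mulc z w : Re (z * w) = Re z * Re w - Im z * Im w.
Proof. by case: z w => x y []. Qed.

Lemma Im_mulc z w : Im (z * w) = Re z * Im w + Im z * Re w.
Proof. by case: z w => x y []. Qed.

Lemma Re_addc z w : Re (z + w) = Re z + Re w.
Proof. by case: z w => x y []. Qed.

Lemma Im_addc z w : Im (z + w) = Im z + Im w.
Proof. by case: z w => x y []. Qed.



Lemma complex_measurable_cst D z : complex_measurable D (cst z).
Proof. by split; exact: measurable_cst. Qed.

Lemma complex_measurableD D f g : complex_measurable D f ->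
  complex_measurable D g -> complex_measurable D (fun t => f t + g t).
Proof.
move=> [f1 f2] [g1 g2]; split.
  by under eq_fun do rewrite Re_addc; exact: measurable_funD.
by under eq_fun do rewrite Im_addc; exact: measurable_funD.
Qed.

Lemma complex_measurableM D f g : complex_measurable D f ->
  complex_measurable D g -> complex_measurable D (fun t => f t * g t).
Proof.
move=> [f1 f2] [g1 g2]; split.
  under eq_fun do rewrite Re_mulc.
  by apply: measurable_funB; exact: measurable_funM.
under eq_fun do rewrite Im_mulc.
by apply: measurable_funD; exact: measurable_funM.
Qed.

Lemma complex_integrableD D f g : measurable D -> complex_integrable D f ->
  complex_integrable D g -> complex_integrable D (fun t => f t + g t).
Proof.
move=> mD [f1 f2] [g1 g2]; split.
  have := integrableD mD f1 g1.
  by apply: eq_integrable => // t _ /=; rewrite Re_addc.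
have := integrableD mD f2 g2.
by apply: eq_integrable => // t _ /=; rewrite Im_addc.
Qed.

Lemma complex_integrableZ D z f : measurable D -> complex_integrable D f ->
  complex_integrable D (fun t => z * f t).
Proof.
move=> mD [f1 f2]; split.
  have := integrableB mD (integrableZl mD (Re z) f1) (integrableZl mD (Im z) f2).
  by apply: eq_integrable => // t _ /=; rewrite Re_mulc.
have := integrableD mD (integrableZl mD (Re z) f2) (integrableZl mD (Im z) f1).
by apply: eq_integrable => // t _ /=; rewrite Im_mulc.
Qed.

Lemma cintegralD D f g : measurable D -> complex_integrable D f ->
  complex_integrable D g ->
  cintegral D (fun t => f t + g t) = cintegral D f + cintegral D g.
Proof.
move=> mD [f1 f2] [g1 g2]; apply/eqP; rewrite eq_complex /= -!RintegralD //.
by apply/andP; split; apply/eqP; apply: eq_Rintegral => t _; rewrite ?Re_addc ?Im_addc.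
Qed.

Lemma cintegralZ D z f : measurable D -> complex_integrable D f ->
  cintegral D (fun t => z * f t) = z * cintegral D f.
Proof.
move=> mD [f1 f2]; apply/eqP; rewrite eq_complex Re_mulc Im_mulc /= -!RintegralZl //.
have i1 c (h : R -> R) : mu.-integrable D (EFin \o h) ->
    mu.-integrable D (EFin \o (fun t => c * h t)).
  by move=> hi; have := integrableZl mD c hi.
rewrite -RintegralB ?i1 // -RintegralD ?i1 //.
by apply/andP; split; apply/eqP; apply: eq_Rintegral => t _; rewrite ?Re_mulc ?Im_mulc.
Qed.

Lemma cintegralB D f g : measurable D -> complex_integrable D f ->
  complex_integrable D g ->
  cintegral D (fun t => f t - g t) = cintegral D f - cintegral D g.
Proof.
move=> mD fi gi; rewrite -[in RHS]mulN1r -cintegralZ // -cintegralD //.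
  by congr cintegral; apply/funext => t; rewrite mulN1r.
exact: complex_integrableZ.
Qed.

Lemma complex_integrableM D k K C : measurable D -> complex_measurable D k ->
  (forall t, D t -> normc (k t) <= C) -> complex_integrable D K ->
  complex_integrable D (fun t => k t * K t).
Proof.
move=> mD [k1 k2] kC [K1 K2].
have kRe t : D t -> `|Re (k t)| <= C.
  by move=> Dt; rewrite (le_trans (normr_Re_le _)) // kC.
have kIm t : D t -> `|Im (k t)| <= C.
  by move=> Dt; rewrite (le_trans (normr_Im_le _)) // kC.
split.
  have := integrableB mD (integrable_bounded_mul mD k1 kRe K1)
    (integrable_bounded_mul mD k2 kIm K2).
  by apply: eq_integrable => // t _ /=; rewrite Re_mulc.
have := integrableD mD (integrable_bounded_mul mD k1 kRe K2)
  (integrable_bounded_mul mD k2 kIm K1).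
by apply: eq_integrable => // t _ /=; rewrite Im_mulc.
Qed.

(* Dominates the modulus of the integral of [f]; it is equivalent to, not equal
   to, the L^1 norm. *)
Definition complex_L1 D f := 2 * \int[mu]_(t in D) (`|Re (f t)| + `|Im (f t)|).

(** The real and imaginary parts are bounded separately by the same quantity, whence the factor 2 in
    [complex_L1]. *)
Lemma normc_cintegralM_le D k K C : measurable D -> complex_measurable D k ->
  (forall t, D t -> normc (k t) <= C) -> complex_integrable D K ->
  normc (cintegral D (fun t => k t * K t)) <= C * complex_L1 D K.
Proof.
move=> mD mk kC Ki; have [i1 i2] := complex_integrableM mD mk kC Ki.
have [K1 K2] := Ki.
have Ni : mu.-integrable D (EFin \o (fun t => `|Re (K t)| + `|Im (K t)|)).
  have := integrableD mD (integrable_abse K1) (integrable_abse K2).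
  by apply: eq_integrable => // t _ /=.
have CNi : mu.-integrable D (EFin \o (fun t => C * (`|Re (K t)| + `|Im (K t)|))).
  by have := integrableZl mD C Ni; apply: eq_integrable => // t _ /=.
have bnd (h : R -> R) : mu.-integrable D (EFin \o h) ->
    (forall t, D t -> `|h t| <= normc (k t) * normc (K t)) ->
    `|\int[mu]_(t in D) h t| <=
    C * \int[mu]_(t in D) (`|Re (K t)| + `|Im (K t)|).
  move=> hi hK; rewrite (le_trans (le_normr_Rintegral mD hi)) //.
  rewrite -RintegralZl //; apply: le_Rintegral => //.
    by have := integrable_abse hi; apply: eq_integrable => // t _ /=.
  move=> t Dt; rewrite (le_trans (hK _ Dt)) // ler_pM ?normc_ge0 ?kC //.
  exact: normc_le.
rewrite (le_trans (normc_le _)) //= /complex_L1 mulrCA mulr_natl mulr2n lerD //.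
  by apply: bnd => // t _; rewrite -ComplexField.Normc.normcM normr_Re_le.
by apply: bnd => // t _; rewrite -ComplexField.Normc.normcM normr_Im_le.
Qed.

Lemma is_derive_continuous (f df : R -> R) :
  (forall t : R, is_derive t 1 f (df t)) -> continuous f.
Proof.
move=> hf t; apply: differentiable_continuous; apply/derivable1_diffP.
by have [] := hf t.
Qed.

Lemma Rintegral_itvoo_antiderivative (f F : R -> R) (a b : R) : a < b ->
  (forall t : R, is_derive t 1 F (f t)) -> continuous f ->
  \int[mu]_(t in `]a, b[) f t = F b - F a.
Proof.
move=> ab dF cf.
have cF := is_derive_continuous dF.
have fi : mu.-integrable `[a, b] (EFin \o f).
  apply: continuous_compact_integrable; first exact: segment_compact.
  exact: continuous_subspaceT.
rewrite Rintegral_itv_bndo_bndc; last first.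
  by apply: integrableS fi => //; exact: subset_itv_oo_cc.
rewrite Rintegral_itv_obnd_cbnd; last first.
  by apply: integrableS fi => //; exact: subset_itv_oc_cc.
rewrite /Rintegral (@continuous_FTC2 _ f F) //.
- exact: continuous_subspaceT.
- split.
  + by move=> t _; have [] := dF t.
  + by apply: cvg_at_right_filter; exact: cF.
  + by apply: cvg_at_left_filter; exact: cF.
- by move=> t _; rewrite derive1E; have [] := dF t.
Qed.

Lemma cexp_iM z (t : R) : cexp ('i * z * t%:C) =
  (expR (- Im z * t) * cos (Re z * t)) +i* (expR (- Im z * t) * sin (Re z * t)).
Proof.
have -> : 'i * z * t%:C = (- Im z * t) +i* (Re z * t).
  by case: z => x y; apply/eqP; rewrite eq_complex /=; apply/andP; split; apply/eqP; ring.
by [].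
Qed.

Lemma is_derive_expM_cos (a b t : R) :
  is_derive t 1 (fun t => expR (a * t) * cos (b * t))
    (a * (expR (a * t) * cos (b * t)) - b * (expR (a * t) * sin (b * t))).
Proof.
apply: trigger_derive; by rewrite /GRing.scale /=; ring.
Qed.

Lemma is_derive_expM_sin (a b t : R) :
  is_derive t 1 (fun t => expR (a * t) * sin (b * t))
    (a * (expR (a * t) * sin (b * t)) + b * (expR (a * t) * cos (b * t))).
Proof.
apply: trigger_derive; by rewrite /GRing.scale /=; ring.
Qed.

Lemma cintegral_cexp z (b : R) : z != 0 -> 0 < b ->
  cintegral `]0, b[ (fun t => cexp ('i * z * t%:C)) =
  (cexp ('i * z * b%:C) - 1) / ('i * z).
Proof.
move=> z0 b0; pose x := Re z; pose y := - Im z.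
pose U t := expR (y * t) * cos (x * t); pose V t := expR (y * t) * sin (x * t).
have dU (t : R) : is_derive t 1 U (y * U t - x * V t) := is_derive_expM_cos y x t.
have dV (t : R) : is_derive t 1 V (y * V t + x * U t) := is_derive_expM_sin y x t.
have [cU cV] := (is_derive_continuous dU, is_derive_continuous dV).
have i0 : 'i * z != 0.
  rewrite mulf_neq0 //; apply/eqP => /(congr1 (@complex.Im R)) /= /eqP.
  by rewrite oner_eq0.
(* Let [c1 +i* c2] be the inverse of ['i * z]. The two coordinates of its product with ['i * z] give
   [h1] and [h2], which say exactly that the coordinates of [(c1 +i* c2) (U +i* V)] are
   antiderivatives of [U] and [V]. *)
have := mulVf i0.
case: (('i * z)^-1) => c1 c2.
have iz : 'i * z = y +i* x.
  by rewrite /x /y; clear; case: z => ? ?; apply/eqP; rewrite eq_complex /=;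
    apply/andP; split; apply/eqP; ring.
rewrite {1}iz => /eqP; rewrite eq_complex /= => /andP[/eqP h1 /eqP h2].
have I1 : \int[mu]_(t in `]0, b[) U t = (c1 * U b - c2 * V b) - (c1 * U 0 - c2 * V 0).
  apply: (@Rintegral_itvoo_antiderivative U (fun t => c1 * U t - c2 * V t)) => //.
  move=> t; apply: trigger_derive; rewrite /GRing.scale /=.
  have -> : c1 * (y * U t - x * V t) - c2 * (y * V t + x * U t) =
    (c1 * y - c2 * x) * U t - (c1 * x + c2 * y) * V t by ring.
  by rewrite h1 h2 mul1r mul0r subr0.
have I2 : \int[mu]_(t in `]0, b[) V t = (c1 * V b + c2 * U b) - (c1 * V 0 + c2 * U 0).
  apply: (@Rintegral_itvoo_antiderivative V (fun t => c1 * V t + c2 * U t)) => //.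
  move=> t; apply: trigger_derive; rewrite /GRing.scale /=.
  have -> : c1 * (y * V t + x * U t) + c2 * (y * U t - x * V t) =
    (c1 * y - c2 * x) * V t + (c1 * x + c2 * y) * U t by ring.
  by rewrite h1 h2 mul1r mul0r addr0.
have U0 : U 0 = 1 by rewrite /U !mulr0 expR0 cos0 mul1r.
have V0 : V 0 = 0 by rewrite /V !mulr0 expR0 sin0 mul1r.
have -> : cintegral `]0, b[ (fun t => cexp ('i * z * t%:C)) =
   (\int[mu]_(t in `]0, b[) U t) +i* (\int[mu]_(t in `]0, b[) V t).
  by rewrite /cintegral; congr (_ +i* _); apply: eq_Rintegral => t _; rewrite cexp_iM.
rewrite I1 I2 U0 V0 cexp_iM -/x -/y -/(U b) -/(V b).
by apply/eqP; rewrite eq_complex /=; apply/andP; split; apply/eqP; ring.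
Qed.

Lemma complex_measurable_cexp (D : set (measurableTypeR R)) z :
  complex_measurable D (fun t => cexp ('i * z * t%:C)).
Proof.
have meas (f : R -> R) : continuous f -> measurable_fun D f.
  by move=> cf; apply: measurable_funTS; exact: continuous_measurable_fun.
have dU := is_derive_expM_cos (- Im z) (Re z).
have dV := is_derive_expM_sin (- Im z) (Re z).
split; under eq_fun do rewrite cexp_iM /=.
  exact: meas (is_derive_continuous dU).
exact: meas (is_derive_continuous dV).
Qed.

End ComplexIntegral.

(** * Uniform Riemann-Lebesgue estimates *)

Section UniformRiemannLebesgue.
Context {R : realType}.
Notation mu := (@lebesgue_measure R).
Notation normc := ComplexField.Normc.normc.
Notation Re := complex.Re.
Notation Im := complex.Im.

Lemma cvg0_normr_le (u v : nat -> R) : (forall n, `|u n| <= v n) ->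
  v n @[n --> \oo] --> (0 : R) -> u n @[n --> \oo] --> (0 : R).
Proof.
move=> uv v0; apply/cvgrPdist_lt => e e0.
move/cvgrPdist_lt : v0 => /(_ _ e0); apply: filterS => n.
rewrite !sub0r !normrN; apply: le_lt_trans.
by rewrite (le_trans (uv n)) // ler_norm.
Qed.

(** The rays []-oo, x[] generate the Borel sets and are stable under intersection; each meets []0,
    c[] in an initial interval, so testing on the intervals []0, b[] suffices. *)
Lemma measurable_fun_itv0_cvg (c C : R) (k : nat -> R -> R) (f : R -> R) :
  (forall n, measurable_fun (`]0, c[ : set (measurableTypeR R)) (k n)) ->
  (forall n t, 0 < t < c -> `|k n t| <= C) ->
  (forall b, 0 < b <= c ->
    \int[mu]_(t in `]0, b[) k n t @[n --> \oo] --> (0 : R)) ->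
  mu.-integrable `]0, c[ (EFin \o f) ->
  \int[mu]_(t in `]0, c[) (k n t * f t) @[n --> \oo] --> (0 : R).
Proof.
move=> mk kC kb fi.
have kb' (b : R) : b <= c -> \int[mu]_(t in `]0, b[) k n t @[n --> \oo] --> (0 : R).
  move=> bc; have [b0|b0] := ltP 0 b; first by apply: kb; rewrite b0.
  apply: cvg_near_cst; apply: nearW => n.
  by rewrite set_itv_ge ?Rintegral_set0 // bnd_simp -leNgt.
have H : (@lebesgue_measure R `]0%R, c[%classic < +oo)%E.
  by rewrite lebesgue_measure_itv /=; case: ifP => // _; rewrite -EFinB ltry.
apply: (@kernel_null_integrable _ (measurableTypeR R) R mu `]0, c[ k C
  _ H mk _ (@RGenInftyO.G R)) => //.
- exact: (@RGenInftyO.measurableE R).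
- move=> _ _ [x ->] [y ->]; exists (Num.min x y); apply/seteqP; split => t /=;
    by rewrite !in_itv /= lt_min => /andP.
- exact: kb'.
- move=> _ [x ->].
  have -> : `]0, c[ `&` `]-oo, x[ = `]0, Num.min c x[%classic :> set R.
    apply/seteqP; split => t /=; rewrite !in_itv /= lt_min.
      by move=> [/andP[-> ->] ->].
    by move=> /and3P[-> -> ->].
  by apply: kb'; rewrite ge_min lexx.
Qed.

Lemma cintegral_itv0_cvg (c C : R) (k : nat -> R -> R[i]) (K : R -> R[i]) :
  (forall n, complex_measurable `]0, c[ (k n)) ->
  (forall n t, 0 < t < c -> normc (k n t) <= C) ->
  (forall b, 0 < b <= c ->
    normc (cintegral `]0, b[ (k n)) @[n --> \oo] --> (0 : R)) ->
  complex_integrable `]0, c[ K ->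
  normc (cintegral `]0, c[ (fun t => k n t * K t)) @[n --> \oo] --> (0 : R).
Proof.
move=> mk kC kb Ki; have [K1 K2] := Ki.
have kRe n t : 0 < t < c -> `|Re (k n t)| <= C.
  by move=> Dt; rewrite (le_trans (normr_Re_le _)) // kC.
have kIm n t : 0 < t < c -> `|Im (k n t)| <= C.
  by move=> Dt; rewrite (le_trans (normr_Im_le _)) // kC.
have mRe n := (mk n).1; have mIm n := (mk n).2.
have bRe b : 0 < b <= c ->
    \int[mu]_(t in `]0, b[) Re (k n t) @[n --> \oo] --> (0 : R).
  by move=> /kb; apply: cvg0_normr_le => n; exact: (normr_Re_le (cintegral _ _)).
have bIm b : 0 < b <= c ->
    \int[mu]_(t in `]0, b[) Im (k n t) @[n --> \oo] --> (0 : R).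
  by move=> /kb; apply: cvg0_normr_le => n; exact: (normr_Im_le (cintegral _ _)).
have c11 := measurable_fun_itv0_cvg mRe kRe bRe K1.
have c12 := measurable_fun_itv0_cvg mRe kRe bRe K2.
have c21 := measurable_fun_itv0_cvg mIm kIm bIm K1.
have c22 := measurable_fun_itv0_cvg mIm kIm bIm K2.
have cvg0D (u v : nat -> R) : u n @[n --> \oo] --> (0 : R) ->
    v n @[n --> \oo] --> (0 : R) -> (`|u n| + `|v n|) @[n --> \oo] --> (0 : R).
  move=> u0 v0.
  have : (`|u n| + `|v n|) @[n --> \oo] --> `|0 : R| + `|0 : R|.
    by apply: cvgD; apply: cvg_norm.
  by rewrite normr0 addr0.
have H := cvg0D _ _ (cvg0D _ _ c11 c22) (cvg0D _ _ c12 c21).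
apply: (cvg0_normr_le _ H) => n; rewrite ger0_norm ?normc_ge0 //.
have kReM (f : R -> R) m : mu.-integrable `]0, c[ (EFin \o f) ->
    mu.-integrable `]0, c[ (EFin \o (fun t => Re (k m t) * f t)).
  apply: (integrable_bounded_mul _ (mRe m)) => // t.
  by rewrite /= in_itv /=; exact: kRe.
have kImM (f : R -> R) m : mu.-integrable `]0, c[ (EFin \o f) ->
    mu.-integrable `]0, c[ (EFin \o (fun t => Im (k m t) * f t)).
  apply: (integrable_bounded_mul _ (mIm m)) => // t.
  by rewrite /= in_itv /=; exact: kIm.
rewrite (le_trans (normc_le _)) //= lerD //.
  rewrite (@eq_Rintegral _ _ _ mu _
    (fun t => Re (k n t) * Re (K t) - Im (k n t) * Im (K t))).
    rewrite RintegralB //; [|exact: kReM|exact: kImM].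
    by rewrite (le_trans (ler_normB _ _)) ?ler_norm.
  by move=> t _; rewrite Re_mulc.
rewrite (@eq_Rintegral _ _ _ mu _
  (fun t => Re (k n t) * Im (K t) + Im (k n t) * Re (K t))).
  rewrite RintegralD //; [|exact: kReM|exact: kImM].
    by rewrite (le_trans (ler_normD _ _)) ?ler_norm.
by move=> t _; rewrite Im_mulc.
Qed.

(** If no [N] works, choosing for each [N] a violating index of rank at least [N] gives a sequence
    of kernels that contradicts [cintegral_itv0_cvg]. The index type is arbitrary so that continuous
    parameters can be included; [P] removes degenerate indices. *)
Lemma cintegral_itv0_uniform (J : Type) (P : J -> Prop) (rank : J -> nat)
    (c C : R) (k : J -> R -> R[i]) (K : R -> R[i]) :
  (forall j, P j -> complex_measurable `]0, c[ (k j)) ->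
  (forall j t, P j -> 0 < t < c -> normc (k j t) <= C) ->
  (forall b, 0 < b <= c -> exists B, forall j, P j ->
    (rank j)%:R * normc (cintegral `]0, b[ (k j)) <= B) ->
  complex_integrable `]0, c[ K ->
  forall e, 0 < e -> exists N, forall j, P j -> (N <= rank j)%N ->
    normc (cintegral `]0, c[ (fun t => k j t * K t)) <= e.
Proof.
move=> mk kC kb Ki e e0; apply: contrapT => /forallNP noN.
have /choice[s hs] : forall N, exists j, [/\ P j, (N <= rank j)%N &
    e < normc (cintegral `]0, c[ (fun t => k j t * K t))].
  move=> N; apply: contrapT => /forallNP H; apply: (noN N) => j Pj Nj.
  by rewrite leNgt; apply/negP => ej; apply: (H j).
have : normc (cintegral `]0, c[ (fun t => k (s n) t * K t)) @[n --> \oo] --> (0 : R).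
  apply: (@cintegral_itv0_cvg _ C) => //.
  - by move=> n; apply: mk; case: (hs n).
  - by move=> n t; apply: kC; case: (hs n).
  - move=> b hb; have [B hB] := kb _ hb.
    (* The shift by one avoids a division by zero: the index [s 0] may have rank 0. *)
    have H0 : B / n.+1%:R @[n --> \oo] --> (0 : R).
      rewrite -(mulr0 B); apply: cvgMr; exact: cvg_harmonic.
    rewrite -(cvg_shiftS (fun n => normc _)).
    apply: (cvg0_normr_le _ H0) => n.
    rewrite ger0_norm ?normc_ge0 // ler_pdivlMr //.
    have [Ps rs _] := hs n.+1.
    rewrite mulrC (le_trans _ (hB _ Ps)) // ler_wpM2r ?normc_ge0 //.
    by rewrite ler_nat.
move/cvgrPdist_lt => /(_ _ e0)[N _ /(_ N (leqnn N))].
rewrite sub0r normrN ger0_norm ?normc_ge0 //.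
by have [_ _ /lt_trans h /h] := hs N; rewrite ltxx.
Qed.
End UniformRiemannLebesgue.

(** * The Fourier transform of K: bounds on its kernel and decay at the integers *)

Section FourierTransform.
Context {R : realType}.
Notation mu := (@lebesgue_measure R).
Notation normc := ComplexField.Normc.normc.
Notation Re := complex.Re.
Notation Im := complex.Im.
Implicit Types (z w : R[i]) (K : R -> R[i]) (n : int).

Definition fourier K z := cintegral I02pi (fun t => cexp ('i * z * t%:C) * K t).

Lemma intr_complex n : n%:~R = (n%:~R : R)%:C :> R[i].
Proof. by rewrite rmorph_int. Qed.

Lemma normc_intr n : normc (n%:~R : R[i]) = `|n|%N%:R.
Proof. by rewrite intr_complex normc_real natr_absz intr_norm. Qed.

Lemma Im_intr n : Im (n%:~R : R[i]) = 0.
Proof. by rewrite intr_complex. Qed.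

Lemma imaginary_neq0 : 'i != 0 :> R[i].
Proof. by rewrite eq_complex /= oner_eq0 andbF. Qed.

Lemma normc_eq0 z : (normc z == 0) = (z == 0).
Proof.
by apply/eqP/eqP => [/Normc.eq0_normc //|->]; rewrite Normc.normc0.
Qed.

Lemma normc_gt0 z : (0 < normc z) = (z != 0).
Proof. by rewrite lt_def normc_ge0 andbT normc_eq0. Qed.


Lemma normcD z w : normc (z + w) <= normc z + normc w.
Proof. exact: le_normcD. Qed.

Lemma normc_iM z (t : R) : 0 <= t -> normc ('i * z * t%:C) = t * normc z.
Proof.
by move=> t0; rewrite !Normc.normcM normc_i mul1r normc_real ger0_norm // mulrC.
Qed.

Lemma normc_cexp_iM z (t : R) : normc (cexp ('i * z * t%:C)) = expR (- Im z * t).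
Proof. by rewrite normc_cexp; congr expR; case: z => x y /=; ring. Qed.

Lemma normc_cexp_iM_le (B t : R) z : 0 <= t <= 2 * pi -> `|Im z| <= B ->
  normc (cexp ('i * z * t%:C)) <= expR (2 * pi * B).
Proof.
move=> /andP[t0 t1] zB; rewrite normc_cexp_iM ler_expR.
rewrite (le_trans (ler_norm _)) // normrM normrN (ger0_norm t0) mulrC.
by rewrite ler_pM.
Qed.

(** The product of [expR pi], which bounds [|e^(i w t)|] for [|Im w| <= 1 / 2] and [0 <= t <= 2 pi],
    of [3 * expR (2 * pi)] from [normc_cexpB1_le], and of [2 * pi] from the range of [t]. *)
Definition strip_lipschitz : R := 6 * pi * expR (3 * pi).

Lemma normc_cexp_iMB_le (t : R) z w : 0 <= t <= 2 * pi -> `|Im w| <= 1 / 2 ->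
  normc (z - w) <= 1 ->
  normc (cexp ('i * z * t%:C) - cexp ('i * w * t%:C)) <=
  strip_lipschitz * normc (z - w).
Proof.
move=> ht hw zw; have /andP[t0 t1] := ht.
have -> : cexp ('i * z * t%:C) - cexp ('i * w * t%:C) =
    cexp ('i * w * t%:C) * (cexp ('i * (z - w) * t%:C) - 1).
  rewrite mulrBr mulr1 -cexpD; congr (cexp _ - _); ring.
rewrite Normc.normcM.
have h1 := normc_cexp_iM_le ht hw.
have := normc_cexpB1_le ('i * (z - w) * t%:C); rewrite normc_iM //.
set d := normc (z - w); have d0 : 0 <= d := normc_ge0 _.
move=> h2.
have td : t * d <= 2 * pi * d by rewrite ler_wpM2r.
have h3 : expR (t * d) <= expR (2 * pi).
  by rewrite ler_expR (le_trans td) // ler_piMr // mulr_ge0 ?pi_ge0.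
have h4 : normc (cexp ('i * (z - w) * t%:C) - 1) <= 3 * expR (2 * pi) * (2 * pi * d).
  rewrite (le_trans h2) // ler_pM ?mulr_ge0 ?expR_ge0 //.
  by rewrite ler_wpM2l.
rewrite (le_trans (ler_pM (normc_ge0 _) (normc_ge0 _) h1 h4)) //.
rewrite /strip_lipschitz (_ : 3 * pi = 2 * pi * (1 / 2) + 2 * pi); last by lra.
rewrite expRD; by rewrite le_eqVlt; apply/orP; left; apply/eqP; ring.
Qed.

Lemma complex_integrable_cst (b : R) z : complex_integrable `]0, b[ (cst z).
Proof.
have H : (@lebesgue_measure R `]0%R, b[%classic < +oo)%E.
  by rewrite lebesgue_measure_itv /=; case: ifP => // _; rewrite -EFinB ltry.
have ci (x : R) : mu.-integrable `]0, b[ (EFin \o cst x).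
  apply: measurable_bounded_integrable => //.
  exists `|x|; split; first by rewrite num_real.
  by move=> M xM t _ /=; exact: ltW.
by split; exact: ci.
Qed.

Lemma complex_integrable_cexp (b : R) z : 0 <= b <= 2 * pi ->
  complex_integrable `]0, b[ (fun t => cexp ('i * z * t%:C)).
Proof.
move=> /andP[b0 b1].
have -> : (fun t : R => cexp ('i * z * t%:C)) =
    (fun t => cexp ('i * z * t%:C) * cst 1 t).
  by apply/funext => t; rewrite mulr1.
apply: (@complex_integrableM _ _ _ _ (expR (2 * pi * `|Im z|))) => //.
- exact: complex_measurable_cexp.
- move=> t /=; rewrite in_itv /= => /andP[t0 tb].
  by apply: normc_cexp_iM_le => //; rewrite (ltW t0) (le_trans (ltW tb)).
- exact: complex_integrable_cst.
Qed.

Lemma fourier_intr_small K : complex_integrable I02pi K ->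
  forall e, 0 < e -> exists N, forall n, (N <= `|n|)%N ->
    normc (fourier K n%:~R) <= e.
Proof.
move=> Ki e e0.
have [|||N hN] := @cintegral_itv0_uniform R int (fun n => n != 0) absz (2 * pi) 1
   (fun n t => cexp ('i * n%:~R * t%:C)) K _ _ _ Ki e e0.
- by move=> n _; exact: complex_measurable_cexp.
- move=> n t _ /andP[t0 t1].
  by rewrite normc_cexp_iM Im_intr oppr0 mul0r expR0.
(* The integral is [(e^(i n b) - 1) / (i n)], with numerator at most 2 in modulus. *)
- move=> b /andP[b0 b1]; exists 2 => n n0.
  rewrite cintegral_cexp ?intr_eq0 //.
  rewrite Normc.normcM Normc.normcV Normc.normcM normc_i mul1r normc_intr.
  rewrite mulrCA mulfV ?pnatr_eq0 ?absz_eq0 // mulr1.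
  rewrite (le_trans (normcB _ _)) // Normc.normc1.
  suff : normc (cexp ('i * n%:~R * b%:C)) <= 1 by lra.
  by rewrite normc_cexp_iM Im_intr oppr0 mul0r expR0.
(* The successor excludes [n = 0], where the closed form of the integral fails. *)
exists N.+1 => n Nn; apply: hN; last exact: ltnW.
by rewrite -absz_gt0 (leq_trans _ Nn).
Qed.

End FourierTransform.

(** * Small Lipschitz constant of the transform near distant integers *)

Section FourierEstimates.
Context {R : realType}.
Notation mu := (@lebesgue_measure R).
Notation normc := ComplexField.Normc.normc.
Notation Re := complex.Re.
Notation Im := complex.Im.
Implicit Types (z w : R[i]) (K : R -> R[i]) (n : int).

(** On an interval of finite length [1 + |K|^2] is integrable, and it dominates both coordinates of
    [K]. *)
Lemma squareIntegrable_complex_integrable K :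
  squareIntegrable I02pi K -> complex_integrable I02pi K.
Proof.
move=> [mRe mIm sqK].
have mRe' : measurable_fun (I02pi : set (measurableTypeR R)) (fun t => Re (K t)) by [].
have mIm' : measurable_fun (I02pi : set (measurableTypeR R)) (fun t => Im (K t)) by [].
have mI : measurable (I02pi : set (measurableTypeR R)) by exact: measurable_itv.
have sqi : mu.-integrable I02pi (EFin \o (fun t => normc (K t) ^+ 2)).
  apply/integrableP; split.
    apply/measurable_EFinP; under eq_fun do rewrite normc_sqr.
    by apply: measurable_funD; exact: measurable_funX.
  apply: le_lt_trans sqK; rewrite le_eqVlt; apply/orP; left; apply/eqP.
  by apply: eq_integral => t _ /=; rewrite ger0_norm // sqr_ge0.
have oi := (complex_integrable_cst (2 * pi) (1 : R[i])).1.
have gi := integrableD mI oi sqi.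
have le1 (x c : R) : `|x| <= c -> `|x| <= `|1 + c ^+ 2|.
  move=> xc; have x0 := normr_ge0 x.
  by rewrite (ger0_norm (addr_ge0 _ (sqr_ge0 _))) //; nra.
split; apply: le_integrable gi => //.
- exact/measurable_EFinP.
- by move=> t _ /=; rewrite lee_fin le1 // normr_Re_le.
- exact/measurable_EFinP.
- by move=> t _ /=; rewrite lee_fin le1 // normr_Im_le.
Qed.

Lemma normc_translate_ge n w : n != 0 -> normc w <= 1 / 2 ->
  `|n|%N%:R / 2 <= normc (n%:~R + w).
Proof.
move=> n0 hw.
have n1 : 1 <= `|n|%N%:R :> R by rewrite (ler_nat _ 1) absz_gt0.
have : normc (n%:~R : R[i]) <= normc (n%:~R + w) + normc w.
  by rewrite -[X in normc X <= _](addrK w) normcB.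
rewrite normc_intr; lra.
Qed.

(** The division by ['i * z] in the closed form gains the decay in [n]; the factor [|w1 - w2|]
    survives because numerator and reciprocal are both Lipschitz. *)
Lemma normc_cintegral_cexpB_le n w1 w2 (b : R) : n != 0 ->
  normc w1 <= 1 / 2 -> normc w2 <= 1 / 2 -> 0 < b <= 2 * pi ->
  `|n|%N%:R * normc (cintegral `]0, b[ (fun t => cexp ('i * (n%:~R + w1) * t%:C))
    - cintegral `]0, b[ (fun t => cexp ('i * (n%:~R + w2) * t%:C))) <=
  (2 * strip_lipschitz + 4 * (expR pi + 1)) * normc (w1 - w2).
Proof.
move=> n0 hw1 hw2 /andP[b0 b1].
set z1 := n%:~R + w1; set z2 := n%:~R + w2; set m := `|n|%N%:R.
have m1 : 1 <= m :> R by rewrite (ler_nat _ 1) absz_gt0.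
have m0 : 0 < m :> R := lt_le_trans ltr01 m1.
have h1 : m / 2 <= normc z1 := normc_translate_ge n0 hw1.
have h2 : m / 2 <= normc z2 := normc_translate_ge n0 hw2.
have zn z : m / 2 <= normc z -> z != 0.
  by rewrite -normc_gt0 => /(lt_le_trans _)-> //; rewrite divr_gt0.
rewrite !cintegral_cexp ?zn //.
set e1 := cexp _; set e2 := cexp _; set d := normc (w1 - w2).
have d0 : 0 <= d := normc_ge0 _.
have zz : z1 - z2 = w1 - w2 by rewrite /z1 /z2; ring.
have Im2 : `|Im z2| <= 1 / 2.
  by rewrite /z2 Im_addc Im_intr add0r (le_trans (normr_Im_le _)).
have b2 : 0 <= b <= 2 * pi by rewrite ltW.
have de : normc (e1 - e2) <= strip_lipschitz * d.
  rewrite /d -zz; apply: normc_cexp_iMB_le => //.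
  rewrite zz (le_trans (normcB _ _)) //; lra.
have ne : normc (e2 - 1) <= expR pi + 1.
  rewrite (le_trans (normcB _ _)) // Normc.normc1 lerD2r.
  have := normc_cexp_iM_le b2 Im2; rewrite (_ : 2 * pi * (1 / 2) = pi) //; lra.
(* The numerators are varied first, then the denominators. The first term uses [m / |z1| <= 2], the
   second also [1 / |z2| <= 2], whence the coefficients 2 and 4. *)
have -> : (e1 - 1) / ('i * z1) - (e2 - 1) / ('i * z2) =
    'i^-1 * ((e1 - e2) * z1^-1 - (w1 - w2) * (e2 - 1) * (z1^-1 * z2^-1)).
  by rewrite -zz; field; apply/and3P; split; [exact: zn|exact: zn|exact: imaginary_neq0].
rewrite Normc.normcM Normc.normcV normc_i invr1 mul1r.
have inv z : m / 2 <= normc z -> m * normc z^-1 <= 2 /\ normc z^-1 <= 2.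
  move=> hz; rewrite Normc.normcV.
  have p : 0 < normc z by rewrite normc_gt0 zn.
  by split; [rewrite ler_pdivrMr //; lra|rewrite -div1r ler_pdivrMr //; lra].
have [i1 _] := inv _ h1; have [_ i2] := inv _ h2.
rewrite (le_trans (ler_wpM2l (ltW m0) (normcB _ _))) // !Normc.normcM -/d.
have q0 := normc_ge0 (z1^-1); have q1 := normc_ge0 (z2^-1).
have t1 : normc (e1 - e2) * (m * normc z1^-1) <= strip_lipschitz * d * 2.
  by rewrite ler_pM ?normc_ge0 // mulr_ge0 // ltW.
have t2 : normc (e2 - 1) * ((m * normc z1^-1) * normc z2^-1) <= (expR pi + 1) * (2 * 2).
  by rewrite ler_pM ?normc_ge0 // ?mulr_ge0 ?ler_pM // ?mulr_ge0 // ltW.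
have t3 := ler_wpM2l d0 t2.
lra.
Qed.

Lemma fourier_translate_small K : complex_integrable I02pi K ->
  forall e, 0 < e -> exists N, forall n, (N <= `|n|)%N -> forall w1 w2,
    normc w1 <= 1 / 2 -> normc w2 <= 1 / 2 ->
    normc (fourier K (n%:~R + w1) - fourier K (n%:~R + w2)) <= e * normc (w1 - w2).
Proof.
move=> Ki e e0.
(* Difference quotients in [w], indexed by [(n, w1, w2)]: a uniform
   Riemann-Lebesgue bound on them is a Lipschitz bound. *)
pose P (j : int * R[i] * R[i]) := [/\ j.1.1 != 0, normc j.1.2 <= 1 / 2,
  normc j.2 <= 1 / 2 & j.1.2 != j.2].
pose c (j : int * R[i] * R[i]) : R[i] := (normc (j.1.2 - j.2))^-1%:C.
pose E z (t : R) : R[i] := cexp ('i * z * t%:C).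
pose k (j : int * R[i] * R[i]) (t : R) : R[i] :=
  c j * (E (j.1.1%:~R + j.1.2) t - E (j.1.1%:~R + j.2) t).
have Ei (b : R) z : 0 < b <= 2 * pi -> complex_integrable `]0, b[ (E z).
  by move=> /andP[b0 b1]; apply: complex_integrable_cexp; rewrite ltW.
have cP j : P j -> normc (c j) * normc (j.1.2 - j.2) = 1.
  move=> [_ _ _ w12]; rewrite normc_real ger0_norm ?invr_ge0 ?normc_ge0 // mulVf //.
  by rewrite normc_eq0 subr_eq0.
have Pd j : P j -> normc (j.1.2 - j.2) <= 1.
  move=> [_ h1 h2 _]; rewrite (le_trans (normcB _ _)) //; lra.
have pi2 : 0 < 2 * @pi R <= 2 * @pi R by apply/andP; split; rewrite ?lexx // mulr_gt0 // pi_gt0.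
have intB (b : R) z1 z2 : 0 < b <= 2 * pi ->
    complex_integrable `]0, b[ (fun t => E z1 t - E z2 t).
  move=> hb; have -> : (fun t => E z1 t - E z2 t) = (fun t => E z1 t + (-1) * E z2 t).
    by apply/funext => t; rewrite mulN1r.
  apply: complex_integrableD; [by []|exact: Ei|apply: complex_integrableZ => //; exact: Ei].
have [||| N hN] := @cintegral_itv0_uniform R _ P (fun j => absz j.1.1) (2 * pi)
   strip_lipschitz k K _ _ _ Ki e e0.
- move=> j _; apply: complex_measurableM; first exact: complex_measurable_cst.
  have -> : (fun t => E (j.1.1%:~R + j.1.2) t - E (j.1.1%:~R + j.2) t) =
     (fun t => E (j.1.1%:~R + j.1.2) t + cst (-1) t * E (j.1.1%:~R + j.2) t).
    by apply/funext => t; rewrite mulN1r.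
  apply: complex_measurableD; first exact: complex_measurable_cexp.
  apply: complex_measurableM; first exact: complex_measurable_cst.
  exact: complex_measurable_cexp.
- move=> j t Pj /andP[t0 t1]; have [n0 h1 h2 _] := Pj.
  (* By [cP] the target is multiplied by [1 = |c j| |w1 - w2|], so that the normalisation cancels on
     both sides. *)
  rewrite /k Normc.normcM -[leRHS]mulr1 -(cP j Pj) [leRHS]mulrCA ler_wpM2l ?normc_ge0 //.
  rewrite (_ : j.1.2 - j.2 = (j.1.1%:~R + j.1.2) - (j.1.1%:~R + j.2)); last by ring.
  apply: normc_cexp_iMB_le.
  + by rewrite !ltW.
  + by rewrite Im_addc Im_intr add0r (le_trans (normr_Im_le _)).
  + by rewrite (_ : _ - _ = j.1.2 - j.2) ?Pd //; ring.
- move=> b hb; exists (2 * strip_lipschitz + 4 * (expR pi + 1)) => j Pj.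
  have [n0 h1 h2 _] := Pj.
  rewrite /k cintegralZ //; last exact: intB.
  rewrite (cintegralB _ (Ei _ _ hb) (Ei _ _ hb)) //.
  rewrite Normc.normcM mulrCA.
  have cx (x : R) : x = normc (c j) * (x * normc (j.1.2 - j.2)).
    by rewrite mulrCA cP // mulr1.
  rewrite [leRHS]cx ler_wpM2l ?normc_ge0 //.
  exact: normc_cintegral_cexpB_le.
exists N.+1 => n Nn w1 w2 h1 h2.
(* The diagonal has no difference quotient and is settled directly; the successor in [N.+1] excludes
   [n = 0]. *)
have [->|w12] := eqVneq w1 w2; first by rewrite !subrr Normc.normc0 mulr0.
have Pj : P (n, w1, w2) by split => //=; rewrite -absz_gt0 (leq_trans _ Nn).
have := hN _ Pj (ltnW Nn).
have EK z : complex_integrable `]0, (2 * pi)[ (fun t => E z t * K t).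
  apply: (@complex_integrableM _ _ _ _ (expR (2 * pi * `|Im z|))) => //.
    exact: complex_measurable_cexp.
  move=> t /=; rewrite in_itv /= => /andP[t0 tb].
  by apply: normc_cexp_iM_le; rewrite // !ltW.
have -> : (fun t => k (n, w1, w2) t * K t) = (fun t => c (n, w1, w2) *
   (E (n%:~R + w1) t * K t - E (n%:~R + w2) t * K t)).
  by apply/funext => t; rewrite /k /=; ring.
rewrite cintegralZ //; last first.
  have -> : (fun t => E (n%:~R + w1) t * K t - E (n%:~R + w2) t * K t) =
     (fun t => E (n%:~R + w1) t * K t + (-1) * (E (n%:~R + w2) t * K t)).
    by apply/funext => t; rewrite mulN1r.
  by apply: complex_integrableD => //; exact: complex_integrableZ.
rewrite cintegralB // Normc.normcM normc_real ger0_norm ?invr_ge0 ?normc_ge0 //.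
by rewrite ler_pdivrMl ?normc_gt0 ?subr_eq0 // [e * _]mulrC; exact.
Qed.

End FourierEstimates.

(** * Fixed points and complex derivatives *)

Section ComplexAnalysis.
Context {R : realType}.
Notation normc := ComplexField.Normc.normc.
Notation Re := complex.Re.
Notation Im := complex.Im.
Implicit Types (z w : R[i]).

Lemma cvg_summable_steps (x : nat -> R) (C q : R) : 0 <= q < 1 ->
  (forall k, `|x k.+1 - x k| <= C * q ^+ k) -> cvgn x.
Proof.
move=> /andP[q0 q1] xC.
have : cvgn (series (fun k => x k.+1 - x k)).
  apply: normed_cvg; apply: (@series_le_cvg _ _ (geometric C q)).
  - by move=> k; exact: normr_ge0.
  - by move=> k; apply: geometric_ge0 => //; have := xC 0%N; rewrite expr0 mulr1; exact: le_trans.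
  - by move=> k; exact: xC.
  - by apply: is_cvg_geometric_series; rewrite ger0_norm.
rewrite (_ : series _ = (fun k => x k - x 0%N)); last first.
  by apply/funext => k; rewrite /series /= telescope_sumr.
move=> h; have -> : x = (fun k => (x k - x 0%N) + x 0%N).
  by apply/funext => k; rewrite subrK.
apply: is_cvgD => //; exact: is_cvg_cst.
Qed.

(** [T] contracts only on the disk, so the iterates from 0 must be kept inside it:
    [|T w| <= |w| / 4 + r / 2] preserves [|w| <= 3 r / 4]. This margin passes to the limit and puts
    the fixed point in the open disk. *)
Lemma disk_contraction_fixpoint (T : R[i] -> R[i]) (r : R) : 0 < r ->
  normc (T 0) <= r / 2 ->
  (forall w1 w2, normc w1 <= r -> normc w2 <= r ->
    normc (T w1 - T w2) <= normc (w1 - w2) / 4) ->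
  exists2 w, normc w < r & T w = w.
Proof.
move=> r0 T0 hT; pose u k := iter k T 0.
have n0 : normc (0 : R[i]) <= r by rewrite Normc.normc0 ltW.
have un k : normc (u k) <= 3 / 4 * r.
  elim: k => [|k IH]; first by rewrite Normc.normc0 mulr_ge0 // ltW.
  have ur : normc (u k) <= r by rewrite (le_trans IH) //; lra.
  have := hT _ _ ur n0; rewrite subr0 => h.
  have := normcD (T (u k) - T 0) (T 0); rewrite subrK /u iterS -/(u k); lra.
have ur k : normc (u k) <= r by rewrite (le_trans (un k)) //; lra.
have step k : normc (u k.+1 - u k) <= r * (4^-1) ^+ k.
  elim: k => [|k IH].
    by rewrite /= subr0 mulr1 (le_trans T0) //; lra.
  rewrite (le_trans (hT _ _ (ur k.+1) (ur k))) // exprSr mulrA.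
  by rewrite ler_wpM2r.
have q4 : 0 <= (4^-1 : R) < 1 by apply/andP; split; lra.
have cRe : cvgn (fun k => Re (u k)).
  apply: (cvg_summable_steps q4) => k; apply: le_trans (step k).
  rewrite -[X in `|X|](_ : Re (u k.+1 - u k) = _) ?normr_Re_le //.
  by case: (u k.+1) (u k) => ? ? [].
have cIm : cvgn (fun k => Im (u k)).
  apply: (cvg_summable_steps q4) => k; apply: le_trans (step k).
  rewrite -[X in `|X|](_ : Im (u k.+1 - u k) = _) ?normr_Im_le //.
  by case: (u k.+1) (u k) => ? ? [].
(* The limit is taken coordinatewise, from the completeness of [R]. *)
pose l := limn (fun k => Re (u k)) +i* limn (fun k => Im (u k)).
have ul e : 0 < e -> exists N, forall k, (N <= k)%N -> normc (l - u k) <= e.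
  move=> e0; have e2 : 0 < e / 2 by rewrite divr_gt0.
  move/cvgrPdist_lt : cRe => /(_ _ e2) h1; move/cvgrPdist_lt : cIm => /(_ _ e2) h2.
  have [N _ hN] := filterI h1 h2.
  exists N => k Nk; have [/ltW a1 /ltW a2] := hN k Nk.
  rewrite (le_trans (normc_le _)) // (splitr e) lerD //.
    by case: (u k) a1.
  by case: (u k) a2.
have lr : normc l <= 3 / 4 * r.
  apply/ler_addgt0Pr => e /ul[N /(_ N (leqnn N)) h].
  rewrite -(subrK (u N) l) (le_trans (normcD _ _)) // addrC lerD //.
exists l; first by rewrite (le_lt_trans lr) //; lra.
have lr' : normc l <= r by rewrite (le_trans lr) //; lra.
apply/eqP; rewrite -subr_eq0 -normc_eq0 eq_le normc_ge0 andbT.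
apply/ler_addgt0Pr => e e0; have e2 : 0 < e / 2 by rewrite divr_gt0.
have [N hN] := ul _ e2.
have h1 := hN N (leqnn N); have h2 := hN N.+1 (leqnSn N).
have := hT _ _ lr' (ur N).
have -> : T l - l = (T l - T (u N)) + - (l - u N.+1) by rewrite /u iterS; ring.
have := normcB (T l - T (u N)) (l - u N.+1).
lra.
Qed.

(** For [Phi] the remainder bound is an integral estimate, so this criterion takes the place of
    differentiation under the integral sign. *)
Lemma is_derive_quadratic (f : R[i]^o -> R[i]^o) (z d : R[i]^o) (C : R) :
  (forall h, normc h <= 1 -> normc (f (z + h) - f z - h * d) <= C * normc h ^+ 2) ->
  is_derive z (1 : R[i]^o) f d.
Proof.
move=> fC.
have C0 : 0 <= C.
  have := fC 1; rewrite Normc.normc1 expr1n mulr1 => /(_ (lexx _)).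
  by apply: le_trans; exact: normc_ge0.
have H : (fun h : R[i]^o => h^-1 *: ((f \o shift z) (h *: (1 : R[i]^o)) - f z)) @ 0^' --> d.
  (* In the partial order of [R[i]], [0 < e] forces the imaginary part of [e] to vanish, so the
     estimate can be carried out in [R]. *)
  apply/cvgrPdist_lt => e; rewrite ltcE /= => /andP[/eqP ei e0].
  have eE : e = (Re e)%:C by case: e ei {e0} => x y /= ->.
  pose r := Num.min 1 (Re e / (C + 1)).
  have r0 : 0 < r by rewrite lt_min ltr01 divr_gt0 // ltr_wpDl.
  apply/nbhs_ballP; exists r%:C; first by rewrite /= ltcE /= eqxx r0.
  move=> h hb h0; have hr : normc h < r.
    by have : (normc (0 - h : R[i]))%:C < r%:C := hb; rewrite ltcR sub0r normcN.
  have hn : 0 < normc h by rewrite normc_gt0.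
  have h1 : normc h <= 1 by rewrite ltW // (lt_le_trans hr) // ge_min lexx.
  rewrite eE.
  have -> : d - h^-1 *: ((f \o shift z) (h *: (1 : R[i]^o)) - f z) =
     - (h^-1 * (f (z + h) - f z - h * d)).
    rewrite /GRing.scale /= mulr1 (addrC h z).
    by move: (f (z + h)) (f z) => a b; field; exact: h0.
  change ((normc (- (h^-1 * (f (z + h) - f z - h * d))))%:C < (Re e)%:C).
  rewrite ltcR normcN Normc.normcM Normc.normcV mulrC ltr_pdivrMr //.
  rewrite (le_lt_trans (fC _ h1)) // expr2 mulrA ltr_pM2r //.
  have : normc h < Re e / (C + 1) by rewrite (lt_le_trans hr) // ge_min lexx orbT.
  rewrite ltr_pdivlMr ?ltr_wpDl // => hh; rewrite (le_lt_trans _ hh) //.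
  by rewrite mulrC ler_wpM2l ?normc_ge0 // lerDl.
split; first by apply/cvg_ex; exists d.
exact: cvg_lim H.
Qed.

End ComplexAnalysis.

(** * The function Phi and its zeros *)

Section CharacteristicFunction.
Context {R : realType}.
Notation mu := (@lebesgue_measure R).
Notation normc := ComplexField.Normc.normc.
Notation Re := complex.Re.
Notation Im := complex.Im.
Implicit Types (z w h : R[i]) (K : R -> R[i]) (n : int).

Definition two_pi_i : R[i] := 2 * pi%:C * 'i.

Lemma normc_two_pi_iM z : normc (two_pi_i * z) = 2 * pi * normc z.
Proof.
rewrite /two_pi_i !Normc.normcM normc_i mulr1 (_ : (2 : R[i]) = (2 : R)%:C); last first.
  by rewrite -(rmorph_nat (real_complex R)).
by rewrite !normc_real !ger0_norm ?pi_ge0.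
Qed.

Lemma two_pi_i_neq0 : two_pi_i != 0.
Proof.
rewrite -normc_gt0 -[two_pi_i]mulr1 normc_two_pi_iM Normc.normc1 mulr1.
by rewrite mulr_gt0 // pi_gt0.
Qed.

Lemma Re_two_pi_iM z : Re (two_pi_i * z) = - (2 * pi * Im z).
Proof.
rewrite /two_pi_i (_ : (2 : R[i]) = (2 : R)%:C); last first.
  by rewrite -(rmorph_nat (real_complex R)).
by case: z => x y /=; ring.
Qed.

Lemma cexp_two_pi_i_intr n : cexp (two_pi_i * n%:~R) = 1.
Proof.
have c1 : cexp two_pi_i = 1.
  have R0 : Re two_pi_i = 0 by rewrite -[two_pi_i]mulr1 Re_two_pi_iM mulr0 oppr0.
  rewrite /cexp R0.
  have -> : Im two_pi_i = pi *+ 2.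
    rewrite /two_pi_i (_ : (2 : R[i]) = (2 : R)%:C); last first.
      by rewrite -(rmorph_nat (real_complex R)).
    by rewrite /= -mulr_natl; ring.
  by rewrite cos2pi sin2pi expR0 mulr1 mulr0.
have cn (m : nat) : cexp (two_pi_i * m%:R) = 1.
  elim: m => [|m IH]; first by rewrite mulr0 cexp0.
  by rewrite -natr1 mulrDr mulr1 cexpD IH c1 mulr1.
case: n => m; first exact: cn.
have := cexpD (two_pi_i * (Negz m)%:~R) (two_pi_i * m.+1%:R).
by rewrite cn mulr1 NegzE mulrNz -mulrDr addNr mulr0 cexp0.
Qed.

Lemma complex_integrable_cexpM K z : complex_integrable I02pi K ->
  complex_integrable I02pi (fun t => cexp ('i * z * t%:C) * K t).
Proof.
move=> Ki; apply: (@complex_integrableM _ _ _ _ (expR (2 * pi * `|Im z|))) => //.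
- exact: measurable_itv.
- exact: complex_measurable_cexp.
- move=> t; rewrite /I02pi /= in_itv /= => /andP[t0 tb].
  by apply: normc_cexp_iM_le => //; rewrite !ltW.
Qed.

Lemma PhiE K z : complex_integrable I02pi K ->
  Phi K z = 1 - cexp (two_pi_i * z) + 'i * fourier K z.
Proof.
move=> Ki; rewrite /Phi -/two_pi_i; congr (_ + _).
have -> : (fun t => cexp ('i * z * t%:C) * - ('i * K t)) =
    (fun t => (- 'i) * (cexp ('i * z * t%:C) * K t)).
  by apply/funext => t; ring.
rewrite cintegralZ ?mulNr ?opprK //; last exact: complex_integrable_cexpM.
exact: measurable_itv.
Qed.

Lemma inner_psiE K n : complex_integrable I02pi K ->
  inner (psi n) K = (Num.sqrt (2 * pi))^-1%:C * fourier K n%:~R.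
Proof.
move=> Ki; rewrite /inner /fourier -cintegralZ //; last 2 first.
- exact: measurable_itv.
- exact: complex_integrable_cexpM.
congr cintegral; apply/funext => t; rewrite mulrA; congr (_ * _).
rewrite /psi (rmorphM conjc); congr (_ * _); first exact: conjc_real.
have -> : - ('i * n%:~R * t%:C) = 'i * (- n)%:~R * t%:C by rewrite mulrNz; ring.
rewrite !cexp_iM !Im_intr !intr_complex /= oppr0 mul0r expR0 !mul1r.
by rewrite mulrNz mulNr cosN sinN opprK.
Qed.

(** The formal derivative, with the integrand differentiated in [z]; [Phi_quadratic] justifies
    it. *)
Definition Phi_derivative K z : R[i] :=
  - (two_pi_i * cexp (two_pi_i * z)) +
  'i * cintegral I02pi (fun t => 'i * t%:C * (cexp ('i * z * t%:C) * K t)).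

Lemma Phi_quadratic K z : complex_integrable I02pi K -> exists C : R,
  forall h, normc h <= 1 ->
    normc (Phi K (z + h) - Phi K z - h * Phi_derivative K z) <= C * normc h ^+ 2.
Proof.
(* One constant serves both exponents [2 pi i h] and [i h t]: each has modulus at most [2 pi |h|],
   hence at most [2 pi]. *)
move=> Ki; pose A := 4 * expR (2 * pi) * (2 * pi) ^+ 2 : R.
have p0 := pi_ge0 R.
pose B := expR (2 * pi * `|Im z|) : R.
exists (normc (cexp (two_pi_i * z)) * A + B * A * complex_L1 I02pi K) => h h1.
have quad z' : normc z' <= 2 * pi * normc h ->
    normc (cexp z' - 1 - z') <= A * normc h ^+ 2.
  move=> hz; rewrite (le_trans (normc_cexpB1D_le _)) //.
  have -> : A * normc h ^+ 2 = 4 * expR (2 * pi) * (2 * pi * normc h) ^+ 2.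
    by rewrite /A; ring.
  rewrite ler_pM ?exprn_ge0 ?normc_ge0 ?mulr_ge0 ?expR_ge0 //.
    by rewrite ler_wpM2l // ler_expR (le_trans hz) // ler_piMr // mulr_ge0.
  by rewrite ler_pXn2r // nnegrE ?normc_ge0 // !mulr_ge0 // normc_ge0.
have mI : measurable (I02pi : set (measurableTypeR R)) by exact: measurable_itv.
have mid : complex_measurable I02pi (fun t : R => t%:C).
  by split => /=; [exact: measurable_id|exact: measurable_cst].
(* The integral terms combine into one kernel, [e^(i z t)] times the second-order remainder of
   [e^(i h t)], which is small uniformly in [t]. The [cst] factors match the measurability
   lemmas. *)
pose k (t : R) : R[i] :=
  cexp ('i * z * t%:C) * (cexp ('i * h * t%:C) + cst (-1) t + cst (- ('i * h)) t * t%:C).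
have mk : complex_measurable I02pi k.
  apply: complex_measurableM; first exact: complex_measurable_cexp.
  apply: complex_measurableD; last first.
    by apply: complex_measurableM => //; exact: complex_measurable_cst.
  by apply: complex_measurableD;
    [exact: complex_measurable_cexp|exact: complex_measurable_cst].
have kB t : I02pi t -> normc (k t) <= B * (A * normc h ^+ 2).
  rewrite /I02pi /= in_itv /= => /andP[t0 t1].
  have t2 : 0 <= t <= 2 * pi by rewrite !ltW.
  rewrite Normc.normcM ler_pM ?normc_ge0 ?normc_cexp_iM_le //.
  rewrite mulNr; apply: quad; rewrite normc_iM ?(ltW t0) //.
  by rewrite ler_wpM2r ?normc_ge0 // ltW.
have mg : complex_measurable I02pi (fun t : R => cst 'i t * t%:C).
  by apply: complex_measurableM => //; exact: complex_measurable_cst.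
have iK := complex_integrable_cexpM _ Ki.
have giK : complex_integrable I02pi
    (fun t => 'i * t%:C * (cexp ('i * z * t%:C) * K t)).
  apply: (complex_integrableM (C := 2 * pi) mI mg _ (iK z)) => t.
  rewrite /I02pi /= in_itv /= => /andP[t0 t1].
  change (normc ('i * t%:C) <= 2 * pi).
  by rewrite -[X in normc (X * _)]mulr1 normc_iM ?Normc.normc1 ?mulr1 ltW.
have kK := normc_cintegralM_le mI mk kB Ki.
have kKE : cintegral I02pi (fun t => k t * K t) =
    fourier K (z + h) - fourier K z -
    h * cintegral I02pi (fun t => 'i * t%:C * (cexp ('i * z * t%:C) * K t)).
  have hgiK := complex_integrableZ h mI giK.
  rewrite /fourier -cintegralZ // -cintegralB // -cintegralB //.
    congr cintegral; apply/funext => t; rewrite /k /cst.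
    rewrite (_ : 'i * (z + h) * t%:C = 'i * z * t%:C + 'i * h * t%:C); last by ring.
    by rewrite cexpD; ring.
  have -> : (fun t : R => cexp ('i * (z + h) * t%:C) * K t - cexp ('i * z * t%:C) * K t) =
      (fun t => cexp ('i * (z + h) * t%:C) * K t + (-1) * (cexp ('i * z * t%:C) * K t)).
    by apply/funext => t; rewrite mulN1r.
  by apply: complex_integrableD => //; exact: complex_integrableZ.
have -> : Phi K (z + h) - Phi K z - h * Phi_derivative K z =
    - (cexp (two_pi_i * z) * (cexp (two_pi_i * h) - 1 - two_pi_i * h)) +
    'i * cintegral I02pi (fun t => k t * K t).
  by rewrite !PhiE // kKE /Phi_derivative mulrDr cexpD; ring.
rewrite (le_trans (normcD _ _)) // normcN !Normc.normcM normc_i mul1r mulrDl lerD //.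
  by rewrite -[leRHS]mulrA ler_wpM2l ?normc_ge0 // quad // normc_two_pi_iM.
by rewrite (le_trans kK) // le_eqVlt; apply/orP; left; apply/eqP; ring.
Qed.

Lemma Phi_translateB K n w1 w2 : complex_integrable I02pi K ->
  Phi K (n%:~R + w1) - Phi K (n%:~R + w2) =
  cexp (two_pi_i * w2) - cexp (two_pi_i * w1) +
  'i * (fourier K (n%:~R + w1) - fourier K (n%:~R + w2)).
Proof.
by move=> Ki; rewrite !PhiE // !mulrDr !cexpD !cexp_two_pi_i_intr; ring.
Qed.

(** Half the expansion rate [expR (- pi) * (expR (- pi) / 2) * (2 * pi)] of the exponential part;
    the Fourier part may consume the other half. *)
Definition Phi_lower : R := expR (- pi) ^+ 2 * pi / 2.

Lemma Phi_lower_gt0 : 0 < Phi_lower.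
Proof. by rewrite divr_gt0 // mulr_gt0 ?pi_gt0 // exprn_gt0 // expR_gt0. Qed.

(** Factor out [e^(2 pi i w2)], of modulus at least [expR (- pi)] since [|Im w2| <= 1 / 2]. The
    condition [|w1 - w2| <= 1 / 2] is what puts [2 pi i (w1 - w2)] within the range of
    [normc_cexpB1_ge]. *)
Lemma Phi_expanding K n w1 w2 : complex_integrable I02pi K ->
  normc w2 <= 1 / 2 -> normc (w1 - w2) <= 1 / 2 ->
  normc (fourier K (n%:~R + w1) - fourier K (n%:~R + w2)) <=
    Phi_lower * normc (w1 - w2) ->
  Phi_lower * normc (w1 - w2) <= normc (Phi K (n%:~R + w1) - Phi K (n%:~R + w2)).
Proof.
move=> Ki h2 h12 hF; have p0 := pi_gt0 R.
rewrite Phi_translateB //.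
set F := _ - fourier _ _ in hF *.
have -> : cexp (two_pi_i * w2) - cexp (two_pi_i * w1) + 'i * F =
    - (cexp (two_pi_i * w2) * (cexp (two_pi_i * (w1 - w2)) - 1) - 'i * F).
  have -> : cexp (two_pi_i * w1) = cexp (two_pi_i * w2) * cexp (two_pi_i * (w1 - w2)).
    by rewrite -cexpD; congr cexp; ring.
  by ring.
rewrite normcN.
have hi : normc ('i * F) = normc F by rewrite Normc.normcM normc_i mul1r.
have := normcD (cexp (two_pi_i * w2) * (cexp (two_pi_i * (w1 - w2)) - 1) - 'i * F) ('i * F).
rewrite subrK hi Normc.normcM => hD.
have e2 : expR (- pi) <= normc (cexp (two_pi_i * w2)).
  rewrite normc_cexp Re_two_pi_iM ler_expR lerN2.
  have := le_trans (normr_Im_le w2) h2; rewrite ler_norml => /andP[_]; nra.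
have e1 : expR (- pi) / 2 * (2 * pi * normc (w1 - w2)) <=
    normc (cexp (two_pi_i * (w1 - w2)) - 1).
  by rewrite -normc_two_pi_iM normc_cexpB1_ge // normc_two_pi_iM; nra.
have e0 := expR_ge0 (- pi : R).
have q0 : 0 <= expR (- pi) / 2 * (2 * pi * normc (w1 - w2)).
  by rewrite !mulr_ge0 ?normc_ge0 ?divr_ge0 // ltW.
have := ler_pM e0 q0 e2 e1.
have -> : expR (- pi) * (expR (- pi) / 2 * (2 * pi * normc (w1 - w2))) =
    2 * (Phi_lower * normc (w1 - w2)) by rewrite /Phi_lower; field.
lra.
Qed.

End CharacteristicFunction.

(** * Simplicity and existence of zeros near an integer *)

Section Roots.
Context {R : realType}.
Notation normc := ComplexField.Normc.normc.
Notation Re := complex.Re.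
Notation Im := complex.Im.
Implicit Types (z w h : R[i]) (K : R -> R[i]) (n : int).

(** If [d = 0], the two bounds give [c |h| <= C |h|^2], which fails for small nonzero [h]. *)
Lemma quadratic_expanding_neq0 (f : R[i] -> R[i]) z d (C c e : R) :
  (forall h, normc h <= 1 -> normc (f (z + h) - f z - h * d) <= C * normc h ^+ 2) ->
  0 < c -> 0 < e ->
  (forall h, normc h <= e -> c * normc h <= normc (f (z + h) - f z)) ->
  d != 0.
Proof.
move=> fC c0 e0 fc; apply/eqP => d0.
have C0 : 0 <= C.
  have := fC 1; rewrite Normc.normc1 expr1n mulr1 => /(_ (lexx _)).
  by apply: le_trans; exact: normc_ge0.
have q0 : 0 < c / 2 / (C + 1) by rewrite !divr_gt0 // ltr_wpDl.
pose t := Num.min 1 (Num.min e (c / 2 / (C + 1))).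
have t0 : 0 < t by rewrite !lt_min ltr01 e0 q0.
have nt : normc t%:C = t by rewrite normc_real gtr0_norm.
have te : t <= e by rewrite !ge_min lexx orbT.
have t1 : t <= 1 by rewrite ge_min lexx.
have : t <= c / 2 / (C + 1) by rewrite !ge_min lexx !orbT.
rewrite ler_pdivlMr ?ltr_wpDl // => tC.
have := fC t%:C; rewrite nt d0 mulr0 subr0 => /(_ t1) h1.
have := fc t%:C; rewrite nt => /(_ te) /le_trans/(_ h1).
by rewrite expr2 mulrA ler_pM2r //; nra.
Qed.

Lemma diskE z (r : R) w : disk z r%:C w = (normc (z - w) < r) :> Prop.
Proof. by rewrite -ltcR. Qed.

Lemma simple_zero_Phi K z (c e : R) : complex_integrable I02pi K ->
  Phi K z = 0 -> 0 < c -> 0 < e ->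
  (forall h, normc h <= e -> c * normc h <= normc (Phi K (z + h) - Phi K z)) ->
  simple_zero (Phi K) z.
Proof.
move=> Ki z0 c0 e0 hc.
have dPhi (w : R[i]^o) :
    is_derive w (1 : R[i]^o) (Phi K : R[i]^o -> R[i]^o) (Phi_derivative K w).
  by have [C hC] := Phi_quadratic w Ki; exact: is_derive_quadratic hC.
split.
- have H w : derivable (Phi K : R[i]^o -> R[i]^o) w 1 by have [] := dPhi w.
  exact: (@filterE _ (nbhs (z : R[i]^o)) _ _ H).
- by case.
- rewrite derive1n1 derive1E; have [_ ->] := dPhi z.
  have [C hC] := Phi_quadratic z Ki.
  exact: quadratic_expanding_neq0 hC c0 e0 hc.
Qed.

(* Below this radius the nonlinear part of [e^(2 pi i w)] has Lipschitz constant
   at most [pi / 4]: [22 pi r e^(6 pi) (2 pi) <= pi / 4]. *)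
Definition root_radius : R := (176 * pi * expR (6 * pi))^-1.

Lemma root_radius_gt0 : 0 < root_radius.
Proof. by rewrite invr_gt0 !mulr_gt0 ?pi_gt0 ?expR_gt0. Qed.

Lemma root_radius_le : root_radius <= 1 / 4.
Proof.
have p2 := pi_ge2 R.
have e1 : 1 <= expR (6 * pi : R).
  by rewrite (le_trans _ (expR_ge1Dx _)) //; lra.
rewrite /root_radius div1r lef_pV2 ?posrE ?mulr_gt0 ?pi_gt0 ?expR_gt0 //.
nra.
Qed.

(** The nonlinear part equals [e^b (e^u - 1 - u) + (e^b - 1) u]: the first term is quadratic in
    [w1 - w2], the second carries the small factor [e^b - 1]. *)
Lemma cexp_two_pi_i_linear (r : R) w1 w2 : r <= root_radius ->
  normc w1 <= r -> normc w2 <= r ->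
  normc (cexp (two_pi_i * w1) - cexp (two_pi_i * w2) - (two_pi_i * w1 - two_pi_i * w2)) <=
  pi / 4 * normc (w1 - w2).
Proof.
move=> rr h1 h2; have p0 := pi_gt0 R.
have r0 : 0 <= r := le_trans (normc_ge0 _) h1.
have r4 : r <= 1 / 4 := le_trans rr root_radius_le.
set d := normc (w1 - w2); have d0 : 0 <= d := normc_ge0 _.
have dr : d <= 2 * r by rewrite (le_trans (normcB _ _)) //; lra.
set b := two_pi_i * w2; set u := two_pi_i * (w1 - w2).
have -> : cexp (two_pi_i * w1) - cexp b - (two_pi_i * w1 - b) =
    cexp b * (cexp u - 1 - u) + (cexp b - 1) * u.
  have -> : cexp (two_pi_i * w1) = cexp b * cexp u.
    by rewrite -cexpD; congr cexp; rewrite /b /u; ring.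
  by rewrite (_ : two_pi_i * w1 - b = u); [ring|rewrite /b /u; ring].
have nb : normc b <= 2 * pi * r by rewrite normc_two_pi_iM ler_wpM2l // mulr_ge0 // ltW.
have nu : normc u = 2 * pi * d by rewrite normc_two_pi_iM.
pose E := expR (2 * pi) : R; pose E2 := expR (4 * pi) : R.
have [E0 E20] : 0 <= E /\ 0 <= E2 by split; exact: expR_ge0.
have eb : expR (normc b) <= E by rewrite ler_expR (le_trans nb) //; nra.
have eu : expR (normc u) <= E2 by rewrite ler_expR nu; nra.
have E1 : 1 <= E2 by rewrite /E2 (le_trans _ (expR_ge1Dx _)) //; lra.
have a1 : normc (cexp b) <= E by rewrite normc_cexp (le_trans (expR_Re_le _)).
have a2 : normc (cexp u - 1 - u) <= 4 * E2 * (2 * pi * d) ^+ 2.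
  rewrite (le_trans (normc_cexpB1D_le _)) // nu ler_wpM2r ?exprn_ge0 //.
    by rewrite !mulr_ge0 // ltW.
  by rewrite ler_wpM2l // -nu.
have a3 : normc (cexp b - 1) <= 3 * E * (2 * pi * r).
  rewrite (le_trans (normc_cexpB1_le _)) // ler_pM ?normc_ge0 ?mulr_ge0 ?expR_ge0 //.
  by rewrite ler_wpM2l.
rewrite (le_trans (normcD _ _)) // (Normc.normcM (cexp b)) (Normc.normcM _ u) nu.
have b1 := ler_pM (normc_ge0 _) (normc_ge0 _) a1 a2.
have D0 : 0 <= 2 * pi * d by rewrite !mulr_ge0 // ltW.
have b2 := ler_wpM2r D0 a3.
rewrite (le_trans (lerD b1 b2)) //.
have EE : expR (6 * pi) = E * E2 :> R by rewrite /E /E2 -expRD; congr expR; lra.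
have rE : r * (176 * pi * (E * E2)) <= 1.
  by move: rr; rewrite /root_radius EE -div1r ler_pdivlMr // !mulr_gt0 ?expR_gt0.
(* [c1] trades one factor [d] for [2 r], and [c2] inserts [E2 >= 1] to reach a common form. The
   coefficients 16 and 6 add up to 22, an eighth of 176. *)
have c1 : E * (4 * E2 * (2 * pi * d) ^+ 2) <= 16 * pi * (E * E2) * r * (2 * pi * d).
  have -> : E * (4 * E2 * (2 * pi * d) ^+ 2) = 8 * pi * (E * E2) * (2 * pi * d) * d by ring.
  have -> : 16 * pi * (E * E2) * r * (2 * pi * d) =
    8 * pi * (E * E2) * (2 * pi * d) * (2 * r) by ring.
  by rewrite ler_wpM2l // !mulr_ge0 // ltW.
have c2 : 3 * E * (2 * pi * r) * (2 * pi * d) <= 6 * pi * (E * E2) * r * (2 * pi * d).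
  have -> : 3 * E * (2 * pi * r) * (2 * pi * d) = 6 * pi * E * r * (2 * pi * d) by ring.
  rewrite ler_wpM2r // ler_wpM2r // ler_wpM2l ?mulr_ge0 // ?(ltW p0) //.
  by rewrite ler_peMr.
have c3 := ler_wpM2r D0 rE.
lra.
Qed.

(** A Newton step with the derivative frozen at [- 2 pi i], that of the exponential part at the
    centre. The two Lipschitz constants [pi / 4], divided by [2 pi], add up to the contraction
    factor 1/4, and [|F(n)| <= pi r] is exactly [|T 0| <= r / 2]. *)
Lemma Phi_root_exists K n (r : R) : complex_integrable I02pi K ->
  0 < r <= root_radius -> normc (fourier K n%:~R) <= pi * r ->
  (forall w1 w2, normc w1 <= 1 / 2 -> normc w2 <= 1 / 2 ->
    normc (fourier K (n%:~R + w1) - fourier K (n%:~R + w2)) <=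
    pi / 4 * normc (w1 - w2)) ->
  exists2 w, normc w < r & Phi K (n%:~R + w) = 0.
Proof.
move=> Ki /andP[r0 rr] Fr Fl; have p0 := pi_gt0 R.
have r2 : r <= 1 / 2 by have := root_radius_le; lra.
pose T w := w + Phi K (n%:~R + w) / two_pi_i.
have ntpi z : normc (z / two_pi_i) = normc z / (2 * pi).
  rewrite Normc.normcM Normc.normcV; congr (_ / _).
  by rewrite -[two_pi_i]mulr1 normc_two_pi_iM Normc.normc1 mulr1.
have [|w1 w2 h1 h2|w wr Tw] := @disk_contraction_fixpoint _ T r r0.
- rewrite /T add0r addr0 ntpi PhiE // cexp_two_pi_i_intr subrr add0r Normc.normcM normc_i mul1r.
  rewrite ler_pdivrMr ?mulr_gt0 //; lra.
- have -> : T w1 - T w2 = ('i * (fourier K (n%:~R + w1) - fourier K (n%:~R + w2)) -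
     (cexp (two_pi_i * w1) - cexp (two_pi_i * w2) - (two_pi_i * w1 - two_pi_i * w2))) / two_pi_i.
    have -> : T w1 - T w2 = (w1 - w2) + (Phi K (n%:~R + w1) - Phi K (n%:~R + w2)) / two_pi_i.
      by rewrite /T; ring.
    by rewrite Phi_translateB //; field; exact: two_pi_i_neq0.
  rewrite ntpi ler_pdivrMr ?mulr_gt0 //.
  rewrite (le_trans (normcB _ _)) // Normc.normcM normc_i mul1r.
  have := Fl w1 w2 (le_trans h1 r2) (le_trans h2 r2).
  have := cexp_two_pi_i_linear rr h1 h2.
  lra.
exists w => //; move/eqP : Tw; rewrite /T -subr_eq0 addrAC subrr add0r.
by rewrite mulf_eq0 invr_eq0 (negPf two_pi_i_neq0) orbF => /eqP.
Qed.

End Roots.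

Local Notation normc := ComplexField.Normc.normc.

Theorem theorem3p11 (R : realType) (K : R -> R[i])
    (hK : squareIntegrable I02pi K) :
  exists N : nat, forall n : int, (N <= `|n|)%N ->
    (inner (psi n) K != 0 ->
       number_of_zeros (Phi K) (disk n%:~R `|inner (psi n) K|) 1) /\
    (inner (psi n) K = 0 ->
       simple_zero (Phi K) n%:~R /\
       forall r : R, r < 1 / 2 ->
         forall z : R[i], disk n%:~R r%:C z -> Phi K z = 0 -> z = n%:~R).
Proof.
have Ki := squareIntegrable_complex_integrable hK.
have p0 := pi_gt0 R; have p2 := pi_ge2 R.
have l0 := @Phi_lower_gt0 R; have rr0 := @root_radius_gt0 R.
(* The Lipschitz constant of the Fourier part has two uses: [Phi_lower] is what the expansion
   tolerates, [pi / 4] what the contraction tolerates. *)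
have e0 : 0 < Num.min Phi_lower (pi / 4 : R) by rewrite lt_min l0 divr_gt0.
have [N1 hN1] := fourier_translate_small Ki e0.
have [N2 hN2] := fourier_intr_small Ki rr0.
exists (maxn N1 N2) => n; rewrite geq_max => /andP[/hN1 osc /hN2 small] {hN1 hN2}.
have lower w1 w2 : normc w1 <= 1 / 2 -> normc w2 <= 1 / 2 -> normc (w1 - w2) <= 1 / 2 ->
    Phi_lower * normc (w1 - w2) <= normc (Phi K (n%:~R + w1) - Phi K (n%:~R + w2)).
  move=> h1 h2 h12; apply: Phi_expanding => //.
  by rewrite (le_trans (osc _ _ h1 h2)) // ler_wpM2r ?normc_ge0 // ge_min lexx.
have unique w1 w2 : normc w1 <= 1 / 2 -> normc w2 <= 1 / 2 -> normc (w1 - w2) <= 1 / 2 ->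
    Phi K (n%:~R + w1) = 0 -> Phi K (n%:~R + w2) = 0 -> w1 = w2.
  move=> h1 h2 h12 z1 z2; have := lower w1 w2 h1 h2 h12.
  rewrite z1 z2 subrr Normc.normc0 pmulr_rle0 // => h.
  by apply/eqP; rewrite -subr_eq0 -normc_eq0 eq_le h normc_ge0.
have simple w : normc w <= 1 / 4 -> Phi K (n%:~R + w) = 0 ->
    simple_zero (Phi K) (n%:~R + w).
  (* With [w] and the increment both bounded by 1/4, [w + h] stays in the disk where [lower]
     holds. *)
  move=> hw zw; apply: (@simple_zero_Phi _ _ _ Phi_lower (1 / 4)) => // h hh.
  have := lower (w + h) w.
  rewrite addrA (addrC w h) addrK; apply; last 2 first.
  - by rewrite (le_trans hw) //; lra.
  - by rewrite (le_trans hh) //; lra.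
  - by rewrite (le_trans (normcD _ _)) //; lra.
rewrite inner_psiE //; set s := Num.sqrt (2 * pi).
have s0 : 0 < s by rewrite sqrtr_gt0 mulr_gt0.
have ss : s * s = 2 * pi by rewrite -expr2 sqr_sqrtr // mulr_ge0 // ltW.
have nF z : normc (s^-1%:C * z) = s^-1 * normc z.
  by rewrite Normc.normcM normc_real ger0_norm // invr_ge0 ltW.
split => [a0|a0].
- pose r := s^-1 * normc (fourier K n%:~R).
  have r0 : 0 < r by rewrite /r -nF normc_gt0.
  have Fr : normc (fourier K n%:~R) = s * r by rewrite /r mulVKf // gt_eqF.
  (* From [s^2 = 2 pi] and [pi >= 2]: [1 <= s] brings [r] below [root_radius], and [s <= pi] turns
     [|F(n)| = s r] into the bound [pi r] that the contraction needs. *)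
  have s1 : 1 <= s by nra.
  have sp : s <= pi by nra.
  have rr : r <= root_radius.
    by rewrite (le_trans _ small) // Fr ler_peMl // ltW.
  have r4 : r <= 1 / 4 by rewrite (le_trans rr) // root_radius_le.
  have [w wr zw] : exists2 w, normc w < r & Phi K (n%:~R + w) = 0.
    apply: Phi_root_exists => //; first by rewrite r0.
      by rewrite Fr ler_wpM2r // ltW.
    move=> w1 w2 h1 h2; rewrite (le_trans (osc _ _ h1 h2)) // ler_wpM2r ?normc_ge0 //.
    by rewrite ge_min lexx orbT.
  have -> : `|s^-1%:C * fourier K n%:~R| = r%:C.
    by rewrite /r -nF.
  exists [:: n%:~R + w], (fun=> 1%N); split => //.
  + move=> z; rewrite inE diskE; split => [/eqP ->|[]].
      by split => //; rewrite opprD addrA subrr add0r normcN.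
    rewrite -normcN opprB => zr z0; apply/eqP.
    rewrite -[LHS](subrK n%:~R) addrC; congr (_ + _).
    apply: unique => //; rewrite ?subrK //.
    * by lra.
    * by lra.
    * by rewrite (le_trans (normcB _ _)) //; lra.
    * by rewrite addrC subrK.
  + by move=> z; rewrite inE => /eqP ->; apply: simple => //; lra.
  + by rewrite big_seq1.
- have F0 : fourier K n%:~R = 0.
    move/eqP : a0; rewrite mulf_eq0 => /orP[|/eqP //].
    by rewrite eq_complex /= invr_eq0 gt_eqF.
  have z0 : Phi K n%:~R = 0 by rewrite PhiE // cexp_two_pi_i_intr subrr F0 mulr0 addr0.
  have n0 : normc 0 = 0 := Normc.normc0 _.
  split.
    by have := simple 0; rewrite n0 addr0; apply => //; lra.
  move=> r r2 z; rewrite diskE -normcN opprB => zr zz.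
  (* Comparison with the zero at the centre: here [w2 = 0], so [unique] reaches every radius below
     1/2. *)
  apply/eqP; rewrite -subr_eq0; apply/eqP; apply: unique; rewrite ?n0 ?subr0 ?addr0 //.
  + by lra.
  + by lra.
  + by rewrite addrC subrK.
Qed.
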